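(* Consider Problem (P1) (single energy arrival at the receiver) described in the context, and let $\{\bm p,\bm s,N\}$ be a policy without breaks ($p_i>0$ for all $i$) satisfying the energy constraint $U(t)\le\mathcal{E}(t)$ for all $t\in[0,s_{N+1}]$. Then $\{\bm p,\bm s,N\}$ is an optimal solution of Problem (P1) if and only if all of the following hold: (1) $\sum_{i=1}^{N} g(p_i)(s_{i+1}-s_i)=B_0$; (2) $p_1\le p_2\le\cdots\le p_N$; (3) for every $i\in\{2,\dots,N\}$ there is some $j$ with $s_i=\tau_j$, and $U(s_i)=\mathcal{E}(s_i^-)$ for every $i\in\{2,\dots,N+1\}$; (4) $s_{N+1}-s_1=\Gamma_0$ if $s_1>0$, and $s_{N+1}\le\Gamma_0$ if $s_1=0$; (5) there exists $s_j\in\bm s$ with $s_j=\tau_q$, where $\tau_q$ is the energy arrival epoch defined in the context.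
   Context: Model. Energy arrives at a transmitter at instants $0=\tau_0<\tau_1<\cdots$ in amounts $\mathcal{E}_0,\mathcal{E}_1,\dots>0$, all known in advance. Put $\mathcal{E}(t)=\sum_{i:\tau_i\le t}\mathcal{E}_i$ and $\mathcal{E}(t^-)=\sum_{i:\tau_i<t}\mathcal{E}_i$ (so $\mathcal{E}(0^-)=0$). The receiver has a single amount $\Gamma_0>0$ of on-time, available from time $0$. Batteries are infinite. Rate function. $g:[0,\infty)\to[0,\infty)$ is monotonically increasing, $g(0)=0$, $\lim_{p\to\infty}g(p)=\infty$, $g$ is concave, and $g(p)/p$ is convex and monotonically decreasing in $p$ with $\lim_{p\to\infty}g(p)/p=0$. Policies. A policy $\{\bm p,\bm s,N\}$ consists of powers $\bm p=\{p_1,\dots,p_N\}$, $p_i\ge0$, and times $\bm s=\{s_1,\dots,s_{N+1}\}$, $0\le s_1<\cdots<s_{N+1}$; power $p_i$ is used on $[s_i,s_{i+1}]$ and the receiver is on exactly when the power is nonzero. $U(t)$ is the energy used up to time $t$ (the integral of the power over $[s_1,t]$; $0$ for $t\le s_1$), and $B(t)$ is the number of bits sent up to time $t$ (the integral of $g(\text{power})$ over $[s_1,t]$; $0$ for $t\le s_1$). Problem (P1): given $B_0>0$, minimize $T=s_{N+1}$ over all policies subject to $B(T)=B_0$, $U(t)\le\mathcal{E}(t)$ for all $t\in[0,T]$, and $\sum_{i:p_i\ne0}(s_{i+1}-s_i)\le\Gamma_0$. Here ''optimal solution of (P1)'' means an optimal solution without breaks, i.e. with $p_i>0$ for all $i$.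 By convention every epoch $\tau_k$ during the transmission with $U(\tau_k)=\mathcal{E}(\tau_k^-)$ is listed in $\bm s$, even if the power does not change there (so consecutive powers may be equal). Definition of $\tau_q$. Let $\tau_n$ be the first energy arrival epoch with $\Gamma_0\,g(\mathcal{E}(\tau_n)/\Gamma_0)\ge B_0$ (assumed to exist). Let $\widetilde\Gamma_0$ solve $\widetilde\Gamma_0\,g(\mathcal{E}(\tau_n)/\widetilde\Gamma_0)=B_0$ and put $p_c=\mathcal{E}(\tau_n)/\widetilde\Gamma_0$. Let $T_{start}\ge 0$ be the earliest time such that transmitting with constant power $p_c$ from $T_{start}$ for a duration $\widetilde\Gamma_0$ satisfies the energy constraint $U(t)\le\mathcal{E}(t)$. For this constant-power policy, $\tau_q$ ($q\le n$) is the first energy arrival epoch $\tau_q\ge T_{start}$ with $U(\tau_q)=\mathcal{E}(\tau_q^-)$.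
   Formalization: g is taken strictly concave; (5) also requires U(s_j)=E(s_j^-); an interior s_i where the power does not change must be an epoch tau_k with U(tau_k)=E(tau_k^-); the arrival epochs are assumed unbounded. Without the first three the claim is false. *)

(* Defs.v *)
From mathcomp Require Import all_boot all_order all_algebra.
From mathcomp Require Import all_classical all_reals all_analysis.
Import Order.TTheory GRing.Theory Num.Theory.
Import numFieldNormedType.Exports.

Set Implicit Arguments.
Unset Strict Implicit.
Unset Printing Implicit Defensive.

Local Open Scope classical_set_scope.
Local Open Scope ring_scope.

(* Only the values of [g] on [0, +oo[ matter.  Concavity is strict: for a
   concave [g] with an affine piece, optimal policies are not unique and need
   neither have nondecreasing powers nor change power only at arrivals. *)
Record rate_function (R : realType) (g : R -> R) : Prop := RateFunction {
  rate_ge0 : forall x, 0 <= x -> 0 <= g x ;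
  rate_incr : forall x y, 0 <= x -> x <= y -> g x <= g y ;
  rate_0 : g 0 = 0 ;
  rate_pinfty : g p @[p --> +oo] --> +oo ;
  rate_strictly_concave : forall x y t, 0 <= x -> 0 <= y -> x != y ->
    0 < t -> t < 1 -> t * g x + (1 - t) * g y < g (t * x + (1 - t) * y) ;
  rate_div_convex :
    convex_function (`]0, +oo[ : set (convex_lmodType R^o))
                    (fun p : R^o => g p / p) ;
  rate_div_decr : forall x y, 0 < x -> x <= y -> g y / y <= g x / x ;
  rate_div_lim : g p / p @[p --> +oo] --> 0
}.

(* [tau] is unbounded, i.e. there are finitely many arrivals in bounded time;
   the sums defining [harvested] and [harvested_before] are then finite. *)
Record arrival_process (R : realType) (tau En : nat -> R) : Prop :=
  ArrivalProcess {
  arrival_0 : tau 0%N = 0 ;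
  arrival_incr : forall i, tau i < tau i.+1 ;
  arrival_unbounded : forall t, exists i, t < tau i ;
  arrival_gt0 : forall i, 0 < En i
}.

(* E(t) and E(t^-) *)
Definition harvested (R : realType) (tau En : nat -> R) (t : R) : R :=
  \sum_(i \in [set i | tau i <= t]) En i.

Definition harvested_before (R : realType) (tau En : nat -> R) (t : R) : R :=
  \sum_(i \in [set i | tau i < t]) En i.

(* Indices start at 1: only [pow i] for 1 <= i <= nseg and [tm i] for
   1 <= i <= nseg.+1 are meaningful; power [pow i] is used between [tm i] and
   [tm i.+1]. *)
Record policy (R : realType) := Policy {
  nseg : nat ;
  pow : nat -> R ;
  tm : nat -> R
}.

Definition wf_policy (R : realType) (P : policy R) : Prop :=
  [/\ (0 < nseg P)%N,
      forall i, (1 <= i <= nseg P)%N -> 0 <= pow P i,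
      0 <= tm P 1
    & forall i, (1 <= i <= nseg P)%N -> tm P i < tm P i.+1].

Definition without_breaks (R : realType) (P : policy R) : Prop :=
  forall i, (1 <= i <= nseg P)%N -> 0 < pow P i.

Definition finish (R : realType) (P : policy R) : R := tm P (nseg P).+1.

Definition power_at (R : realType) (P : policy R) (t : R) : R :=
  \sum_(1 <= i < (nseg P).+1) pow P i * \1_(`[tm P i, tm P i.+1[) t.

(* U(t) and B(t); the interval of integration is empty when [t < tm P 1]. *)
Definition energy_used (R : realType) (P : policy R) (t : R) : R :=
  \int[lebesgue_measure]_(x in `[tm P 1, t]) power_at P x.

Definition bits_sent (R : realType) (g : R -> R) (P : policy R) (t : R) : R :=
  \int[lebesgue_measure]_(x in `[tm P 1, t]) g (power_at P x).

Definition on_time (R : realType) (P : policy R) : R :=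
  \sum_(1 <= i < (nseg P).+1 | pow P i != 0) (tm P i.+1 - tm P i).

Definition energy_feasible (R : realType) (tau En : nat -> R) (P : policy R) :
    Prop :=
  forall t, 0 <= t -> t <= finish P -> energy_used P t <= harvested tau En t.

Definition feasible (R : realType) (g : R -> R) (tau En : nat -> R)
    (Gamma0 B0 : R) (P : policy R) : Prop :=
  [/\ wf_policy P,
      bits_sent g P (finish P) = B0,
      energy_feasible tau En P
    & on_time P <= Gamma0].

(* The competitors [Q] may have breaks. *)
Definition optimal (R : realType) (g : R -> R) (tau En : nat -> R)
    (Gamma0 B0 : R) (P : policy R) : Prop :=
  [/\ feasible g tau En Gamma0 B0 P,
      without_breaks P
    & forall Q, feasible g tau En Gamma0 B0 Q -> finish P <= finish Q].

(* All the energy arrived strictly before [t] is used up at [t]. *)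
Definition exhausted (R : realType) (tau En : nat -> R) (P : policy R)
    (t : R) : Prop :=
  energy_used P t = harvested_before tau En t.

(* Convention on the breakpoints.  Since equal consecutive powers are allowed,
   a policy has many presentations; the one meant here lists every arrival
   epoch of the transmission at which the energy is exhausted, and has no
   other interior breakpoint at which the power does not change. *)
Definition standard_breakpoints (R : realType) (tau En : nat -> R)
    (P : policy R) : Prop :=
  (forall k, tm P 1 <= tau k -> tau k <= finish P ->
     exhausted tau En P (tau k) ->
     exists2 i, (1 <= i <= (nseg P).+1)%N & tm P i = tau k) /\
  (forall i, (2 <= i <= nseg P)%N -> pow P i.-1 = pow P i ->
     exists2 k, tm P i = tau k & exhausted tau En P (tm P i)).

Definition constant_policy (R : realType) (p start duration : R) : policy R :=
  Policy 1 (fun=> p)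
    (fun i => if (i <= 1)%N then start else start + duration).

Definition is_first_sufficient_epoch (R : realType) (g : R -> R)
    (tau En : nat -> R) (Gamma0 B0 : R) (n : nat) : Prop :=
  B0 <= Gamma0 * g (harvested tau En (tau n) / Gamma0) /\
  (forall m, (m < n)%N ->
     Gamma0 * g (harvested tau En (tau m) / Gamma0) < B0).

Definition is_earliest_start (R : realType) (tau En : nat -> R)
    (p duration start : R) : Prop :=
  [/\ 0 <= start,
      energy_feasible tau En (constant_policy p start duration)
    & forall start', 0 <= start' ->
        energy_feasible tau En (constant_policy p start' duration) ->
        start <= start'].

Definition is_first_exhaustion_epoch (R : realType) (tau En : nat -> R)
    (P : policy R) (q : nat) : Prop :=
  [/\ tm P 1 <= tau q,
      exhausted tau En P (tau q)
    & forall k, tm P 1 <= tau k -> exhausted tau En P (tau k) -> (q <= k)%N].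

(* [is_tau_q g tau En Gamma0 B0 q] says that tau_q is the epoch determined by
   the data through tau_n ([n]), the duration [D] and the starting time [S] of
   the constant-power policy; these are uniquely determined. *)
Definition is_tau_q (R : realType) (g : R -> R) (tau En : nat -> R)
    (Gamma0 B0 : R) (q : nat) : Prop :=
  exists (n : nat) (D S : R),
    let p_c := harvested tau En (tau n) / D in
    [/\ is_first_sufficient_epoch g tau En Gamma0 B0 n,
        0 < D /\ D * g p_c = B0,
        is_earliest_start tau En p_c D S
      & is_first_exhaustion_epoch tau En (constant_policy p_c S D) q].

(* Main.v *)
Require Import Defs.
From mathcomp Require Import all_boot all_order all_algebra.
From mathcomp Require Import all_classical all_reals all_analysis.
From mathcomp Require Import ring lra zify.
Import Order.TTheory GRing.Theory Num.Theory.
Import numFieldNormedType.Exports.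
Local Open Scope classical_set_scope.
Local Open Scope ring_scope.
Set Implicit Arguments.
Unset Strict Implicit.
Unset Printing Implicit Defensive.

(* For a power p > 0, strict concavity gives a strict tangent
   g y < mu p + l p * y (y != p) with mu p, l p > 0: the bits of any policy are
   at most its on-time priced at mu p plus its energy priced at l p. As p grows,
   l p decreases and mu p increases, so summing these bounds over the segments
   of a policy P satisfying (1)-(4) and using that P has exhausted the energy at
   its breakpoints shows that no competitor sends B0 bits strictly earlier,
   except possibly when P is a single segment started after time 0; then (5)
   would give Gamma0 * g (E(tau_(q-1)) / Gamma0) = B0, against the choice of
   tau_n, since q <= n.

   Conversely an optimal policy cannot be modified, within the same final time,
   so as to send more than B0 bits, as the result could be truncated. Averaging
   two decreasing powers, averaging around a breakpoint with unused energy,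
   raising the last power, and starting earlier are such modifications and give
   (2)-(4). For (5), the energy used by P is affine between points where it is
   above the line of the constant-power policy, hence is above that line at
   tau_q, where the line meets E(tau_q^-). *)

(** * Energy, bits and on-time as finite sums over segments *)

(** For [a <= b], the length of the part of [a, b] before [t]. As a difference of minima it
    telescopes over consecutive segments. *)
Definition overlap (R : realType) (a b t : R) : R := Num.min b t - Num.min a t.

(** One sum for the three resources: energy for [c = id], bits for [c = g], on-time for
    [c = on_indicator]. *)
Definition cumul (R : realType) (c : R -> R) (P : policy R) (t : R) : R :=
  \sum_(1 <= i < (nseg P).+1) c (pow P i) * overlap (tm P i) (tm P i.+1) t.

Definition on_indicator (R : realType) (y : R) : R := (y != 0)%:R.

Section Overlap.
Variable R : realType.
Implicit Types a b s t : R.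

Lemma overlap_ge a b t : a <= b -> b <= t -> overlap a b t = b - a.
Proof. by rewrite /overlap => ? ?; rewrite !min_l //; lra. Qed.

Lemma overlap_le a b t : a <= b -> t <= a -> overlap a b t = 0.
Proof. by rewrite /overlap => ? ?; rewrite !min_r //; lra. Qed.

Lemma overlap_mid a b t : a <= t -> t <= b -> overlap a b t = t - a.
Proof. by rewrite /overlap => ? ?; rewrite min_r // min_l. Qed.

Lemma overlap_mono a b s t : a <= b -> s <= t -> overlap a b s <= overlap a b t.
Proof.
by rewrite /overlap => ? ?; case: (leP b s); case: (leP a s); case: (leP b t);
  case: (leP a t) => *; lra.
Qed.

Lemma overlap_lip a b s t : a <= b -> s <= t ->
  overlap a b t - overlap a b s <= t - s.
Proof.
by rewrite /overlap => ? ?; case: (leP b s); case: (leP a s); case: (leP b t);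
  case: (leP a t) => *; lra.
Qed.

Lemma overlap_ge0 a b t : a <= b -> 0 <= overlap a b t.
Proof.
by rewrite /overlap => ?; case: (leP b t); case: (leP a t) => *; lra.
Qed.

Lemma fine_measure_overlap (a x y t : R) : a <= x -> x <= y ->
  fine (lebesgue_measure (`[x, y[ `&` `[a, t] : set R)) = overlap x y t.
Proof.
move=> ax xy; have [tx|xt] := ltP t x.
  have -> : `[x, y[ `&` `[a, t] = set0 :> set R.
    by apply/seteqP; split => u //=; rewrite !in_itv /= => -[] *; lra.
  by rewrite overlap_le ?(ltW tx) // measure0.
have [ty|yt] := ltP t y.
  have -> : `[x, y[ `&` `[a, t] = `[x, t]%classic :> set R.
    apply/seteqP; split => u /=; rewrite !in_itv /=.
      by case=> /andP[xu uy] /andP[au ut]; rewrite xu ut.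
    by case/andP=> xu ut; rewrite xu ut (le_lt_trans ut ty) (le_trans ax xu).
  rewrite overlap_mid ?(ltW ty) // lebesgue_measure_itv /= lte_fin.
  by case: ltP => //= h; lra.
have -> : `[x, y[ `&` `[a, t] = `[x, y[%classic :> set R.
  apply/seteqP; split => u /=; rewrite !in_itv /=; first by case.
  by case/andP=> xu uy;
    rewrite xu uy (le_trans ax xu) (ltW (lt_le_trans uy yt)).
rewrite overlap_ge // lebesgue_measure_itv /= lte_fin.
by case: ltP => //= h; lra.
Qed.

Lemma Rintegral_step (c x y : nat -> R) (n : nat) a t :
  (forall i, (1 <= i < n)%N -> a <= x i /\ x i <= y i) ->
  \int[lebesgue_measure]_(u in `[a, t])
     (\sum_(1 <= i < n) c i * \1_(`[x i, y i[) u) =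
  \sum_(1 <= i < n) c i * overlap (x i) (y i) t.
Proof.
set mu := lebesgue_measure; move=> axy.
have int1 (i : nat) : mu.-integrable `[a, t] (EFin \o \1_(`[x i, y i[)).
  exact: integrableS (integrable_indic_itv _ _ _ _).
have intc i :
    mu.-integrable `[a, t] (EFin \o (fun u => c i * \1_(`[x i, y i[) u)).
  by rewrite (_ : _ \o _ =
    (fun u => (c i)%:E * (EFin \o \1_(`[x i, y i[)) u)%E);
    [exact: integrableZl|exact/funext].
have intS m : mu.-integrable `[a, t]
    (EFin \o (fun u => \sum_(1 <= i < m) c i * \1_(`[x i, y i[) u)).
  rewrite (_ : _ \o _ = (fun u => \sum_(1 <= i < m)
     (c i * \1_(`[x i, y i[) u)%R%:E)%E); last first.
    by apply/funext => u /=; rewrite sumEFin.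
  by apply: integrable_sum => // i _; exact: intc.
elim: n axy => [|n IH] axy.
  rewrite big_geq //; under eq_Rintegral do rewrite big_geq //.
  by rewrite Rintegral_cst // mul0r.
(* Indices start at 1, so the range is still empty here when [n = 0] and there is no last term to
   split off. *)
case: (posnP n) => [->|n0].
  rewrite big_geq //; under eq_Rintegral do rewrite big_geq //.
  by rewrite Rintegral_cst // mul0r.
rewrite big_nat_recr //=; under eq_Rintegral do rewrite big_nat_recr //=.
rewrite RintegralD //.
rewrite IH; last first.
  by move=> i /andP[i1 ilt]; apply: axy; rewrite i1 (ltn_trans ilt).
congr (_ + _); rewrite RintegralZl //; congr (_ * _).
have [ax xy] : a <= x n /\ x n <= y n by apply: axy; rewrite n0 /=.
rewrite /Rintegral integral_indic //; exact: fine_measure_overlap.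
Qed.

End Overlap.

Section PolicyCumul.
Variables (R : realType) (P : policy R).
Hypothesis wfP : wf_policy P.
Implicit Types (c : R -> R) (s t : R).

Lemma tm_lt i j : (1 <= i)%N -> (i < j)%N -> (j <= (nseg P).+1)%N ->
  tm P i < tm P j.
Proof.
have [_ _ _ lt_tm] := wfP.
move=> i1; elim: j => // j IH; rewrite ltnS leq_eqVlt => /predU1P[<-|ij] jN.
  by apply: lt_tm; lia.
by apply: (lt_trans (IH ij (ltnW jN))); apply: lt_tm; lia.
Qed.

Lemma tm_le i j : (1 <= i)%N -> (i <= j)%N -> (j <= (nseg P).+1)%N ->
  tm P i <= tm P j.
Proof.
by move=> i1; rewrite leq_eqVlt => /predU1P[->//|ij] jN; rewrite ltW ?tm_lt.
Qed.

Lemma tm_step i : (1 <= i < (nseg P).+1)%N -> tm P i <= tm P i.+1.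
Proof. by move=> h; apply: tm_le; lia. Qed.

(** The half-open segments are disjoint, so at most one term is nonzero at [u]. Outside all of them
    the power is 0, whence [c 0 = 0]. *)
Lemma power_atE c u : c 0 = 0 ->
  c (power_at P u) =
  \sum_(1 <= i < (nseg P).+1) c (pow P i) * \1_(`[tm P i, tm P i.+1[) u.
Proof.
move=> c0; rewrite /power_at.
have [[k /andP[kN uk]]|none] := pselect (exists k,
    (1 <= k < (nseg P).+1)%N && (tm P k <= u < tm P k.+1)).
  have off (f : nat -> R) i : (1 <= i < (nseg P).+1)%N && (i != k) ->
      f i * \1_(`[tm P i, tm P i.+1[) u = 0.
    move=> /andP[iN ik]; rewrite indicE memNset ?mulr0 //= in_itv /=.
    move=> /andP[iu ui]; case/andP: uk => ku uk.
    move: ik; rewrite neq_ltn => /orP[] lt.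
      suff : tm P i.+1 <= tm P k by lra.
      by apply: tm_le; lia.
    suff : tm P k.+1 <= tm P i by lra.
    by apply: tm_le; lia.
  have sumE (f : nat -> R) :
      \sum_(1 <= i < (nseg P).+1) f i * \1_(`[tm P i, tm P i.+1[) u = f k.
    rewrite (bigD1_seq k) ?mem_index_iota ?iota_uniq //= big_seq_cond.
    rewrite big1 ?addr0.
      by rewrite indicE mem_set ?mulr1 //= in_itv.
    by move=> i; rewrite mem_index_iota; exact: off.
  by rewrite !sumE.
have off (f : nat -> R) :
    \sum_(1 <= i < (nseg P).+1) f i * \1_(`[tm P i, tm P i.+1[) u = 0.
  rewrite big_seq big1 // => i; rewrite mem_index_iota => iN.
  rewrite indicE memNset ?mulr0 //= in_itv /= => ui.
  by apply: none; exists i; rewrite iN.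
by rewrite !off.
Qed.

Lemma Rintegral_power_at c t : c 0 = 0 ->
  \int[lebesgue_measure]_(u in `[tm P 1, t]) c (power_at P u) = cumul c P t.
Proof.
move=> c0; under eq_Rintegral do rewrite power_atE //.
rewrite Rintegral_step // => i iN; split; last exact: tm_step.
by apply: tm_le; lia.
Qed.

Lemma energy_usedE t : energy_used P t = cumul id P t.
Proof. exact: (@Rintegral_power_at id). Qed.

Lemma bits_sentE (g : R -> R) t : g 0 = 0 -> bits_sent g P t = cumul g P t.
Proof. exact: Rintegral_power_at. Qed.

Lemma cumul_finish c t : finish P <= t ->
  cumul c P t = \sum_(1 <= i < (nseg P).+1) c (pow P i) * (tm P i.+1 - tm P i).
Proof.
move=> Ft; apply: eq_big_nat => i iN; rewrite overlap_ge ?tm_step //.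
by apply: le_trans Ft; apply: tm_le; lia.
Qed.

Lemma cumul_start c t : t <= tm P 1 -> cumul c P t = 0.
Proof.
move=> tS; rewrite /cumul big_seq big1 // => i; rewrite mem_index_iota => iN.
rewrite overlap_le ?mulr0 ?tm_step //; apply: le_trans tS _.
by apply: tm_le; lia.
Qed.

Lemma cumul_segment c k t : (1 <= k <= nseg P)%N ->
  tm P k <= t -> t <= tm P k.+1 ->
  cumul c P t = cumul c P (tm P k) + c (pow P k) * (t - tm P k).
Proof.
move=> kN kt tk; have kin : k \in index_iota 1 (nseg P).+1.
  by rewrite mem_index_iota; lia.
rewrite /cumul (bigD1_seq k) ?iota_uniq //=.
rewrite [in RHS](bigD1_seq k) ?iota_uniq //=.
rewrite (overlap_mid kt) // (@overlap_le _ (tm P k) _ (tm P k)) //; last first.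
  by apply: tm_step; lia.
rewrite mulr0 add0r addrC; congr (_ + _).
rewrite big_seq_cond [RHS]big_seq_cond; apply: eq_bigr => i.
rewrite mem_index_iota => /andP[iN ik]; congr (_ * _).
move: ik; rewrite neq_ltn => /orP[] lt.
  have ? : tm P i.+1 <= tm P k by apply: tm_le; lia.
  by rewrite !overlap_ge ?tm_step //; lra.
have ? : tm P k.+1 <= tm P i by apply: tm_le; lia.
by rewrite !overlap_le ?tm_step //; lra.
Qed.

(** A crude Lipschitz constant, enough to pass to left limits in the energy constraint. *)
Lemma cumul_lip c s t : (forall y, 0 <= y -> 0 <= c y) -> s <= t ->
  cumul c P t - cumul c P s <=
  (\sum_(1 <= i < (nseg P).+1) c (pow P i)) * (t - s).
Proof.
have [_ p0 _ _] := wfP; move=> c0 st; rewrite /cumul -sumrB mulr_suml.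
rewrite big_seq [leRHS]big_seq; apply: ler_sum => i.
rewrite mem_index_iota => iN.
rewrite -mulrBr; apply: ler_wpM2l; first by apply/c0/p0; lia.
by rewrite overlap_lip // tm_step.
Qed.

Lemma on_timeE : on_time P = cumul (@on_indicator R) P (finish P).
Proof.
rewrite cumul_finish // /on_time big_mkcond /=; apply: eq_bigr => i _.
by rewrite /on_indicator; case: eqP => _ /=; rewrite ?mul0r ?mul1r.
Qed.

(** On-time grows at most at unit speed, and not at all after the finish. The minima record the
    latter, on which [remaining_gt0] rests. *)
Lemma on_cumul_lip s t : s <= t ->
  cumul (@on_indicator R) P t - cumul (@on_indicator R) P s <=
  Num.min (finish P) t - Num.min (finish P) s.
Proof.
have [N0 _ _ _] := wfP; move=> st.
apply: (@le_trans _ _ (\sum_(1 <= i < (nseg P).+1)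
    (overlap (tm P i) (tm P i.+1) t - overlap (tm P i) (tm P i.+1) s))).
  rewrite /cumul -sumrB big_seq [leRHS]big_seq; apply: ler_sum => i.
  rewrite mem_index_iota => iN; rewrite -mulrBr ler_piMl //.
    by rewrite subr_ge0 overlap_mono ?tm_step.
  by rewrite /on_indicator; case: eqP.
rewrite sumrB /overlap !telescope_sumr // /finish.
have : tm P 1 <= tm P (nseg P).+1 by apply: tm_le.
by case: (leP (tm P 1) s); case: (leP (tm P 1) t) => *; lra.
Qed.

End PolicyCumul.

Lemma on_cumul_without_breaks (R : realType) (P : policy R) t :
  wf_policy P -> without_breaks P ->
  cumul (@on_indicator R) P t = overlap (tm P 1) (finish P) t.
Proof.
move=> [N0 _ _ _] p0.
transitivity (\sum_(1 <= i < (nseg P).+1) overlap (tm P i) (tm P i.+1) t).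
  apply: eq_big_nat => i iN.
  by rewrite /on_indicator gt_eqF ?mul1r //; apply: p0; lia.
by rewrite /overlap telescope_sumr // ltnS ltnW.
Qed.

(** * The arrival process and the step functions E(t) and E(t^-) *)

Section Arrivals.
Variables (R : realType) (tau En : nat -> R).
Hypothesis arr : arrival_process tau En.
Implicit Types (s t : R) (i j k m n : nat).
Local Notation E := (harvested tau En).
Local Notation Em := (harvested_before tau En).

Lemma tau_mono : {mono tau : i j / (i <= j)%N >-> i <= j}.
Proof.
have hom : {homo tau : i j / (i < j)%N >-> i < j}.
  by apply: homo_ltn; [exact: lt_trans|exact: arrival_incr arr].
exact: (@le_mono _ _ nat R tau hom).
Qed.

Lemma tau_lt i j : (tau i < tau j) = (i < j)%N.
Proof. by rewrite !ltNge tau_mono -ltnNge. Qed.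

Lemma fsbig_prefix (A : set nat) m : (forall i, A i <-> (i < m)%N) ->
  \sum_(i \in A) En i = \sum_(i < m) En i.
Proof.
move=> Am; rewrite fsbig_ord; apply: eq_fsbigl.
by apply/seteqP; split => i /= /Am.
Qed.

(** The first arrival that fails a condition closed downwards in time bounds those that satisfy it;
    this turns E(t) and E(t^-) into sums of the first [m] amounts. *)
Lemma count_arrivals (p : pred R) :
  (forall s t, s <= t -> p t -> p s) -> (exists i, ~~ p (tau i)) ->
  exists m, forall i, p (tau i) <-> (i < m)%N.
Proof.
move=> pdown pex; exists (ex_minn pex) => i.
case: ex_minnP => m npm min; split => [pi|im].
  rewrite ltnNge; apply: contra npm => mi; apply: pdown pi.
  by rewrite tau_mono.
by apply: contraT => /min; rewrite leqNgt im.
Qed.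

Lemma count_le t : exists m, forall i, tau i <= t <-> (i < m)%N.
Proof.
apply: (@count_arrivals (fun s => s <= t)) => [s u|]; first exact: le_trans.
by have [i ti] := arrival_unbounded arr t; exists i; rewrite -ltNge.
Qed.

Lemma count_lt t : exists m, forall i, tau i < t <-> (i < m)%N.
Proof.
apply: (@count_arrivals (fun s => s < t)) => [s u|]; first exact: le_lt_trans.
by have [i ti] := arrival_unbounded arr t; exists i; rewrite -leNgt ltW.
Qed.

Lemma prefix_mono m n : (m <= n)%N -> \sum_(i < m) En i <= \sum_(i < n) En i.
Proof.
elim: n => [|n IH]; first by rewrite leqn0 => /eqP ->.
rewrite leq_eqVlt ltnS => /predU1P[->//|/IH h].
by rewrite big_ord_recr /=; have := arrival_gt0 arr n; lra.
Qed.

Lemma harvested_mono s t : s <= t -> E s <= E t.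
Proof.
move=> st; have [[m sm] [n tn]] := (count_le s, count_le t).
rewrite /harvested (fsbig_prefix sm) (fsbig_prefix tn) prefix_mono // leqNgt.
by apply/negP => nm; have /tn := le_trans ((sm n).2 nm) st; rewrite ltnn.
Qed.

Lemma harvested_before_le t : Em t <= E t.
Proof.
have [[m sm] [n tn]] := (count_lt t, count_le t).
rewrite /harvested /harvested_before (fsbig_prefix sm) (fsbig_prefix tn).
rewrite prefix_mono // leqNgt.
by apply/negP => nm; have /tn := ltW ((sm n).2 nm); rewrite ltnn.
Qed.

Lemma harvested_le_before s t : s < t -> E s <= Em t.
Proof.
move=> st; have [[m sm] [n tn]] := (count_le s, count_lt t).
rewrite /harvested /harvested_before (fsbig_prefix sm) (fsbig_prefix tn).
rewrite prefix_mono // leqNgt.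
by apply/negP => nm; have /tn := le_lt_trans ((sm n).2 nm) st; rewrite ltnn.
Qed.

Lemma harvested_before_ge0 t : 0 <= Em t.
Proof.
have [n tn] := count_lt t; rewrite /harvested_before (fsbig_prefix tn).
by rewrite sumr_ge0 // => i _; rewrite ltW ?(arrival_gt0 arr).
Qed.

Lemma harvested_ge0 t : 0 <= E t.
Proof. exact: le_trans (harvested_before_ge0 t) (harvested_before_le t). Qed.

Lemma harvested_before_left t :
  exists2 s0, s0 < t & forall s, s0 <= s -> Em t <= E s.
Proof.
have [m tm] := count_lt t; rewrite /harvested_before (fsbig_prefix tm).
case: m tm => [|m] tm.
  exists (t - 1); first lra.
  by move=> s _; rewrite big_ord0 harvested_ge0.
exists (tau m); first exact/tm.
move=> s ms; have [n sn] := count_le s; rewrite /harvested (fsbig_prefix sn).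
by rewrite prefix_mono //; apply/sn.
Qed.

(** Until the next arrival [s0] nothing is added to E(t^-). *)
Lemma harvested_right_nonarrival t : (forall j, t <> tau j) ->
  exists2 s0, t < s0 & forall s, s < s0 -> E s <= Em t.
Proof.
move=> tN; have [m tm] := count_lt t; exists (tau m).
  have : ~ tau m < t by move/tm; rewrite ltnn.
  by move/negP; rewrite -leNgt le_eqVlt => /predU1P[/tN []|].
move=> s sm; have [n sn] := count_le s.
rewrite /harvested /harvested_before (fsbig_prefix sn) (fsbig_prefix tm).
rewrite prefix_mono // leqNgt; apply/negP => mn.
by have := (sn m).2 mn; rewrite leNgt sm.
Qed.

Lemma harvested_tau k : E (tau k) = \sum_(i < k.+1) En i.
Proof. by apply: fsbig_prefix => i /=; rewrite tau_mono ltnS. Qed.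

Lemma harvested_before_tau k : Em (tau k) = \sum_(i < k) En i.
Proof. by apply: fsbig_prefix => i /=; rewrite tau_lt. Qed.

Lemma harvested_before_tauS k : Em (tau k.+1) = E (tau k).
Proof. by rewrite harvested_tau harvested_before_tau. Qed.

Lemma harvested_before_tau_lt k : Em (tau k) < E (tau k).
Proof.
rewrite harvested_tau harvested_before_tau big_ord_recr /=.
by have := arrival_gt0 arr k; lra.
Qed.

Lemma harvested_lt_tau t k : t < tau k -> E t < E (tau k).
Proof.
move=> /harvested_le_before h.
exact: le_lt_trans h (harvested_before_tau_lt k).
Qed.

Lemma harvested_before_0 : Em 0 = 0.
Proof. by have := harvested_before_tau 0; rewrite (arrival_0 arr) big_ord0. Qed.

Lemma harvested_ge_En0 t : 0 <= t -> En 0%N <= E t.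
Proof.
move=> t0; apply: le_trans (harvested_mono t0).
by have := harvested_tau 0; rewrite (arrival_0 arr) big_ord1 => ->.
Qed.

(** Allows an energy bound at an arbitrary [t] to be checked at the next arrival. *)
Lemma harvested_next t : exists m, [/\ t < tau m, E t = Em (tau m)
  & forall i, t < tau i -> (m <= i)%N].
Proof.
have [m tm] := count_le t; exists m; split.
- by rewrite ltNge; apply/negP => /tm; rewrite ltnn.
- by rewrite harvested_before_tau /harvested (fsbig_prefix tm).
- by move=> i; rewrite ltNge; apply: contraR; rewrite -ltnNge => /tm.
Qed.

Lemma harvested_tau_gt0 k : 0 < E (tau k).
Proof.
exact: le_lt_trans (harvested_before_ge0 (tau k)) (harvested_before_tau_lt k).
Qed.

Lemma tau_ge0 k : 0 <= tau k.
Proof. by rewrite -(arrival_0 arr) tau_mono. Qed.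

End Arrivals.

(** * Tangents of the rate function and the prices they define *)

Section RateFunction.
Variables (R : realType) (g : R -> R).
Hypothesis rate : rate_function g.
Implicit Types (p x y : R).

(* The slope is the supremum of the chord slopes to the right of [p]. *)
Lemma strict_supergradient p : 0 < p ->
  exists l, forall y, 0 <= y -> y != p -> g y < g p + l * (y - p).
Proof.
move=> p0; have conc := rate_strictly_concave rate.
have slope x y : 0 <= x -> x < p -> p < y ->
    (g y - g p) * (p - x) < (g p - g x) * (y - p).
  move=> x0 xp py.
  have d0 : 0 < y - x by lra.
  pose t := (y - p) / (y - x).
  have t0 : 0 < t by rewrite divr_gt0 //; lra.
  have t1 : t < 1 by rewrite ltr_pdivrMr //; lra.
  have xy : x != y by rewrite lt_eqF //; lra.
  have tE : t * (y - x) = y - p by rewrite divfK // gt_eqF.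
  have := conc x y t x0 ltac:(lra) xy t0 t1.
  have -> : t * x + (1 - t) * y = p by lra.
  by rewrite -(ltr_pM2r d0); nra.
pose A := [set (g y - g p) / (y - p) | y in [set y | p < y]].
have A0 : A !=set0.
  by exists ((g (p + 1) - g p) / (p + 1 - p)), (p + 1) => //=; lra.
have ubA x : 0 <= x -> x < p -> ubound A ((g p - g x) / (p - x)).
  move=> x0 xp _ [y /= py <-].
  rewrite ler_pdivrMr; last lra.
  by rewrite mulrAC ler_pdivlMr; [exact/ltW/slope|lra].
have weak y : 0 <= y -> g y <= g p + sup A * (y - p).
  move=> y0; have [py|yp|->] := ltgtP p y; last by lra.
    have : (g y - g p) / (y - p) <= sup A.
      apply: ub_le_sup; first by exists ((g p - g 0) / (p - 0)); exact: ubA.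
      by exists y.
    by rewrite ler_pdivrMr; lra.
  have : sup A <= (g p - g y) / (p - y) by apply: ge_sup => //; exact: ubA.
  by rewrite ler_pdivlMr; lra.
(* The weak inequality at the midpoint of [y] and [p], together with strict concavity there, becomes
   strict at [y]. *)
exists (sup A) => y y0 yp; have := conc y p 2^-1 y0 (ltW p0) yp.
have := weak (2^-1 * y + (1 - 2^-1) * p).
by lra.
Qed.

(** [g] need not be differentiable, so a strict supergradient is chosen; the default 0 can occur
    only for [p <= 0]. *)
Definition slope p : R := 
  if pselect (exists l, forall y, 0 <= y -> y != p -> g y < g p + l * (y - p))
  is left h then projT1 (cid h) else 0.

Lemma slopeP p y : 0 < p -> 0 <= y -> y != p ->
  g y < g p + slope p * (y - p).
Proof.
rewrite /slope => p0; case: pselect => [h|]; first by case: cid => l /=; apply.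
by move/strict_supergradient: p0.
Qed.

(* [intercept p] is the price of on-time and [slope p] the price of energy when
   the power is [p]. *)
Definition intercept p : R := g p - slope p * p.

Lemma le_tangent p y : 0 < p -> 0 <= y -> g y <= intercept p + slope p * y.
Proof.
rewrite /intercept => p0 y0; have [->|yp] := eqVneq y p; first lra.
by have := slopeP p0 y0 yp; lra.
Qed.

Lemma slope_gt0 p : 0 < p -> 0 < slope p.
Proof.
move=> p0; have p1 : 0 <= p + 1 by lra.
have := slopeP p0 p1; rewrite gt_eqF ?ltrDl // => /(_ isT).
have := rate_incr rate (ltW p0) (_ : p <= p + 1); rewrite lerDl => /(_ ler01).
lra.
Qed.

Lemma intercept_gt0 p : 0 < p -> 0 < intercept p.
Proof.
move=> p0; have := slopeP p0 (lexx 0); rewrite lt_eqF // => /(_ isT).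
by rewrite /intercept (rate_0 rate); lra.
Qed.

(** The two tangent inequalities, each taken at the other point, add up to the comparison of slopes.
    The intercepts follow: at [x > 0] the tangent of [y] lies above [g x] although it is flatter. *)
Lemma slope_intercept_lt x y : 0 < x -> x < y ->
  slope y < slope x /\ intercept x < intercept y.
Proof.
move=> x0 xy; have y0 : 0 < y by lra.
have xy1 := slopeP x0 (ltW y0) (negbT (gt_eqF xy)).
have xy2 := slopeP y0 (ltW x0) (negbT (lt_eqF xy)).
have sl : slope y < slope x by rewrite -(ltr_pM2r (_ : 0 < y - x)); lra.
split => //; rewrite /intercept.
have : 0 < (slope x - slope y) * x by rewrite mulr_gt0 ?subr_gt0.
lra.
Qed.

Lemma slope_intercept_le x y : 0 < x -> x <= y ->
  slope y <= slope x /\ intercept x <= intercept y.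
Proof.
move=> x0; rewrite le_eqVlt => /predU1P[->|] // xy.
by have [/ltW ? /ltW ?] := slope_intercept_lt x0 xy.
Qed.

(** On-time is charged only for nonzero powers, so the breaks of a competitor cost nothing. *)
Lemma le_priced p y : 0 < p -> 0 <= y ->
  g y <= intercept p * on_indicator y + slope p * y.
Proof.
rewrite /on_indicator => p0 y0; have [->|yN0] := eqVneq y 0.
  by rewrite (rate_0 rate) /=; lra.
by rewrite mulr1 le_tangent.
Qed.

(** The condition excludes exactly the powers 0 and [p], at which the priced bound is attained. *)
Lemma lt_priced p y : 0 < p -> 0 <= y -> y != p * on_indicator y ->
  g y < intercept p * on_indicator y + slope p * y.
Proof.
rewrite /on_indicator => p0 y0; have [->|yN0] := eqVneq y 0.
  by rewrite mulr0 eqxx.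
by rewrite !mulr1 /intercept => /(slopeP p0 y0) ?; lra.
Qed.

Lemma rate_lt x y : 0 <= x -> x < y -> g x < g y.
Proof.
move=> x0 xy; have y0 : 0 < y by lra.
have := slopeP y0 x0 (negbT (lt_eqF xy)).
have : 0 < slope y * (y - x) by rewrite mulr_gt0 ?slope_gt0 ?subr_gt0.
lra.
Qed.

(** Both sides are compared with the tangent at [e / D']: the energy term is the same, and the
    positive intercept is collected for longer. *)
Lemma perspective_lt e D D' : 0 < e -> 0 < D -> D < D' ->
  D * g (e / D) < D' * g (e / D').
Proof.
move=> e0 D0 DD'; have D'0 : 0 < D' by lra.
have ? : D' != 0 by rewrite gt_eqF.
have ? : D != 0 by rewrite gt_eqF.
have p0 : 0 < e / D' by rewrite divr_gt0.
have q0 : 0 < e / D by rewrite divr_gt0.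
have ne : e / D != e / D'.
  by rewrite gt_eqF // ltr_pM2l // ltf_pV2 // posrE.
have h := slopeP p0 (ltW q0) ne; rewrite -(ltr_pM2l D0) in h.
apply: (lt_le_trans h).
rewrite (_ : D * _ = D * intercept (e / D') + slope (e / D') * e).
  rewrite (_ : D' * _ = D' * intercept (e / D') + slope (e / D') * e).
    by rewrite lerD2r ler_pM2r ?intercept_gt0 // ltW.
  by rewrite /intercept; field.
by rewrite /intercept; field; apply/andP.
Qed.

End RateFunction.

(** * Priced bounds on bits, and the energy constraint at left limits *)

Section Priced.
Variables (R : realType) (g : R -> R) (Q : policy R).
Hypotheses (rate : rate_function g) (wfQ : wf_policy Q).
Implicit Types (p s t : R).
Local Notation U := (cumul id Q).
Local Notation O := (cumul (@on_indicator R) Q).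

Lemma cumul_priced c d t :
  \sum_(1 <= i < (nseg Q).+1) (c * on_indicator (pow Q i) + d * pow Q i) *
     overlap (tm Q i) (tm Q i.+1) t = c * O t + d * U t.
Proof.
rewrite /cumul !mulr_sumr -big_split /=; apply: eq_bigr => i _.
by rewrite mulrDl !mulrA.
Qed.

Lemma cumul_le_priced p s t : 0 < p -> s <= t ->
  cumul g Q t - cumul g Q s <=
  intercept g p * (O t - O s) + slope g p * (U t - U s).
Proof.
have [_ q0 _ _] := wfQ; move=> p0 st.
rewrite !mulrBr addrACA -opprD -!cumul_priced -!sumrB big_seq [leRHS]big_seq.
apply: ler_sum => i; rewrite mem_index_iota => iN; rewrite -!mulrBr.
apply: ler_wpM2r; first by rewrite subr_ge0 overlap_mono ?tm_step.
by apply: le_priced => //; apply: q0; lia.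
Qed.

(** Equality of the sums forces equality on each segment, so every power is 0 or [p]. *)
Lemma priced_eq_power p t : 0 < p -> finish Q <= t ->
  cumul g Q t = intercept g p * O t + slope g p * U t ->
  forall s, U s = p * O s.
Proof.
have [_ q0 _ lt_tm] := wfQ; move=> p0 Ft /eqP; rewrite eq_sym -subr_eq0.
rewrite -cumul_priced -sumrB big_nat_cond.
rewrite psumr_eq0 => [|i /andP[iN _]]; last first.
  rewrite -mulrBl mulr_ge0 ?overlap_ge0 ?tm_step // subr_ge0 le_priced //.
  by apply: q0; lia.
move=> /allP qP s; rewrite /cumul mulr_sumr; apply: eq_big_nat => i iN.
rewrite mulrA; congr (_ * _).
have /implyP := qP i ltac:(by rewrite mem_index_iota).
rewrite iN => /(_ isT); rewrite -mulrBl mulf_eq0 => /orP[]; last first.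
  have lti := lt_tm i ltac:(lia).
  rewrite overlap_ge ?(ltW lti) ?subr_eq0 ?gt_eqF //.
  by apply: le_trans Ft; apply: tm_le => //; lia.
rewrite subr_eq0 => /eqP qi; apply/eqP/contraT => qN.
have := lt_priced rate p0 (q0 i ltac:(lia)) qN.
by rewrite qi ltxx.
Qed.

End Priced.

Section EnergyFeasible.
Variables (R : realType) (tau En : nat -> R) (P : policy R).
Hypotheses (arr : arrival_process tau En) (wfP : wf_policy P).
Hypothesis feasP : energy_feasible tau En P.
Implicit Types (s t : R).
Local Notation E := (harvested tau En).
Local Notation Em := (harvested_before tau En).

(** The constraint is imposed only up to the finish, after which the energy used is constant. *)
Lemma cumul_le_harvested t : 0 <= t -> cumul id P t <= E t.
Proof.
move=> t0; have [tF|Ft] := leP t (finish P).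
  by rewrite -energy_usedE //; exact: feasP.
have [N0 _ S0 _] := wfP.
have F0 : 0 <= finish P by apply: le_trans S0 _; apply: tm_le.
apply: le_trans (harvested_mono arr (ltW Ft)).
rewrite cumul_finish ?(ltW Ft) // -(cumul_finish wfP id (lexx _)).
rewrite -energy_usedE //.
exact: feasP.
Qed.

(** The energy used is continuous, and E(s) is at most E(t^-) for every [s < t]. *)
Lemma cumul_le_harvested_before t : 0 <= t -> cumul id P t <= Em t.
Proof.
have [N0 p0 S0 _] := wfP.
rewrite le_eqVlt => /predU1P[<-|t0].
  by rewrite cumul_start // harvested_before_ge0.
apply/ler_addgt0Pr => e e0.
set K := \sum_(1 <= i < (nseg P).+1) pow P i.
have K0 : 0 <= K.
  rewrite /K big_seq sumr_ge0 // => i.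
  by rewrite mem_index_iota => ?; apply: p0; lia.
have [d d0 Kd] : exists2 d, 0 < d & K * d <= e.
  (* [K + 1] because [K] may be 0. *)
  exists (e / (K + 1)); first by rewrite divr_gt0 //; lra.
  by rewrite mulrCA ger_pMr // ler_pdivrMr; lra.
pose s := Num.max 0 (t - d).
have [s0 st ts] : [/\ 0 <= s, s < t & t - s <= d].
  by rewrite /s; case: (leP 0 (t - d)) => h; split; lra.
have := cumul_le_harvested s0.
have := harvested_le_before arr st.
have := cumul_lip wfP (fun y (h : 0 <= y) => h : 0 <= id y) (ltW st).
have : K * (t - s) <= K * d by rewrite ler_wpM2l.
rewrite -/K; lra.
Qed.

End EnergyFeasible.

(** * Sufficiency: comparison with a faster competitor *)

Section Comparison.
Variables (R : realType) (g : R -> R) (tau En : nat -> R) (P Q : policy R).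
Hypotheses (rate : rate_function g) (arr : arrival_process tau En).
Hypotheses (wfP : wf_policy P) (wfQ : wf_policy Q).
Hypothesis p_gt0 : without_breaks P.
Hypothesis feasQ : energy_feasible tau En Q.
Hypothesis p_mono : forall i, (1 <= i < nseg P)%N -> pow P i <= pow P i.+1.
Hypothesis exhP : forall i, (2 <= i <= (nseg P).+1)%N ->
  energy_used P (tm P i) = harvested_before tau En (tm P i).
Hypothesis finish_lt : finish Q < finish P.
Hypothesis on_le : on_time Q <= finish P - tm P 1.
Hypothesis bits_eq : cumul g Q (finish Q) = cumul g P (finish P).

Local Notation T := (finish P).
Local Notation U := (cumul id).
Local Notation O := (cumul (@on_indicator R) Q).

(* The on-time left to [P] at [t], minus the on-time left to [Q]. *)
Let r t := (T - t) - (O T - O t).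

Lemma pow_le i j : (1 <= i)%N -> (i <= j <= nseg P)%N -> pow P i <= pow P j.
Proof.
move=> i1; elim: j => [|j IH]; first by lia.
case/andP; rewrite leq_eqVlt => /predU1P[->//|ij jN].
by apply: le_trans (IH _) (p_mono _); lia.
Qed.

(** The on-time left to [Q] is at most [finish Q - t], or 0 once [Q] has finished; either is less
    than [T - t]. *)
Lemma remaining_gt0 t : t < T -> 0 < r t.
Proof.
move=> tT; have := on_cumul_lip wfQ (ltW tT); have := finish_lt.
by rewrite /r (min_l (ltW finish_lt)); case: (leP (finish Q) t) => *; lra.
Qed.

Lemma cumul_finishQ c t : finish Q <= t -> cumul c Q t = cumul c Q (finish Q).
Proof. by move=> Ft; rewrite !cumul_finish. Qed.

Lemma on_excess_le0 : O T - (T - tm P 1) <= 0.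
Proof. by rewrite subr_le0 (cumul_finishQ _ (ltW finish_lt)) -on_timeE. Qed.

Lemma energy_excess_le0 i : (2 <= i <= (nseg P).+1)%N ->
  U Q (tm P i) - U P (tm P i) <= 0.
Proof.
have [_ _ S0 _] := wfP; move=> iN; rewrite subr_le0 -(energy_usedE wfP) exhP //.
apply: cumul_le_harvested_before => //.
by apply: le_trans S0 _; apply: tm_le => //; lia.
Qed.

(* Over each segment of [P] the bits of [Q] are bounded by the energy and the
   on-time it uses there, at the prices given by the power of [P]; Abel
   summation applies since the price of energy decreases with the power and
   that of on-time increases. *)
Lemma priced_excess k : (1 <= k <= nseg P)%N ->
  let rhs := intercept g (pow P 1) * (O T - (T - tm P 1)) +
    intercept g (pow P k) * r (tm P k.+1) +
    slope g (pow P k) * (U Q (tm P k.+1) - U P (tm P k.+1)) in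
  let lhs := cumul g Q (tm P k.+1) - cumul g P (tm P k.+1) in
  lhs <= rhs /\ (pow P 1 < pow P k -> lhs < rhs).
Proof.
have [_ _ S0 lt_tm] := wfP; have [_ _ SQ0 _] := wfQ.
elim: k => // k IH kN.
have ltk := lt_tm k.+1 kN.
have gE j : g (pow P j) = intercept g (pow P j) + slope g (pow P j) * pow P j.
  by rewrite /intercept; ring.
have pk : 0 < pow P k.+1 by exact: p_gt0.
have segP c : cumul c P (tm P k.+2) = cumul c P (tm P k.+1) +
    c (pow P k.+1) * (tm P k.+2 - tm P k.+1).
  by apply: cumul_segment => //; exact: ltW.
case: k => [|k] in IH kN pk ltk segP *.
  split; last by rewrite ltxx.
  (* [Q] may start before [P], so for the first segment its use is counted from time 0. *)
  have t0 : 0 <= tm P 2 by apply/ltW/(le_lt_trans S0).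
  have := cumul_le_priced rate wfQ pk t0.
  rewrite !(cumul_start wfQ _ SQ0) !segP !(cumul_start wfP _ (lexx _)) !gE.
  rewrite /r /=.
  lra.
have kN' : (1 <= k.+1 < nseg P)%N by move: kN; clear; lia.
have kN2 : (2 <= k.+2 <= (nseg P).+1)%N by move: kN; clear; lia.
have {IH}[le_k lt_k] := IH (ltnW kN').
have := cumul_le_priced rate wfQ pk (ltW ltk).
have pk' : 0 < pow P k.+1 by exact/p_gt0/ltnW.
have pkk : pow P k.+1 <= pow P k.+2 by exact: p_mono.
have x0 := energy_excess_le0 kN2.
have r0 : 0 < r (tm P k.+2).
  by apply: remaining_gt0; rewrite /finish tm_lt //; case/andP: kN'.
(* Passing to the prices of the next segment can only raise the bound: the smaller slope multiplies
   a nonpositive energy excess, the larger intercept the positive [r]. *)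
have [sl ic] := slope_intercept_le rate pk' pkk.
have E1 : slope g (pow P k.+1) * (U Q (tm P k.+2) - U P (tm P k.+2)) <=
          slope g (pow P k.+2) * (U Q (tm P k.+2) - U P (tm P k.+2)).
  by rewrite ler_wnM2r.
have E2 : intercept g (pow P k.+1) * r (tm P k.+2) <=
          intercept g (pow P k.+2) * r (tm P k.+2).
  by rewrite ler_wpM2r // ltW.
rewrite !segP gE; set rhs := (X in _ <= X -> _); move=> inc.
have step : intercept g (pow P k.+2) * r (tm P k.+3) = 
   intercept g (pow P k.+2) * r (tm P k.+2) +
   intercept g (pow P k.+2) * (O (tm P k.+3) - O (tm P k.+2))
   - intercept g (pow P k.+2) * (tm P k.+3 - tm P k.+2).
  by rewrite /r; ring.
split; first (by rewrite step /=; move: inc le_k E1 E2; rewrite /rhs /=; lra).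
move=> lt1.
suff : cumul g Q (tm P k.+2) - cumul g P (tm P k.+2) <
    intercept g (pow P 1) * (O T - (T - tm P 1)) +
    intercept g (pow P k.+2) * r (tm P k.+2) +
    slope g (pow P k.+2) * (U Q (tm P k.+2) - U P (tm P k.+2)).
  by rewrite step /=; move: inc; rewrite /rhs /=; lra.
(* Either strictness comes from an earlier increase of the power, or the power increases here and
   the intercept grows strictly against [r > 0]. *)
have [eqk|ltk1] := eqVneq (pow P k.+1) (pow P k.+2).
  by rewrite -eqk in lt1 *; exact: lt_k.
have ltkk : pow P k.+1 < pow P k.+2 by rewrite lt_neqAle ltk1.
have [_ ic'] := slope_intercept_lt rate pk' ltkk.
have : intercept g (pow P k.+1) * r (tm P k.+2) <
       intercept g (pow P k.+2) * r (tm P k.+2).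
  by rewrite ltr_pM2r.
lra.
Qed.

(** At [T] the excess of bits and [r] vanish, so the two nonpositive terms left in [priced_excess]
    are 0 and no increase of power occurs. Hence [P] has constant power, and [Q] uses the same total
    on-time and energy. *)
Lemma faster_policy : 0 < tm P 1 /\ nseg P = 1%N.
Proof.
have [N0 _ S0 lt_tm] := wfP; have [NQ _ SQ0 _] := wfQ.
have p1 : 0 < pow P 1 by apply: p_gt0; rewrite N0.
have pN : 0 < pow P (nseg P) by apply: p_gt0; rewrite N0 /=.
have [le_N lt_N] := @priced_excess (nseg P) (introT andP (conj N0 (leqnn _))).
have rT : r T = 0 by rewrite /r !subrr.
move: le_N lt_N; rewrite -/T rT mulr0 addr0 cumul_finishQ ?(ltW finish_lt) //.
rewrite bits_eq subrr => le_N lt_N.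
have w0 := on_excess_le0.
have x0 : U Q T - U P T <= 0 by apply: energy_excess_le0; rewrite ltnS N0 /=.
have ic0 := intercept_gt0 rate p1; have sl0 := slope_gt0 rate pN.
have E1 : intercept g (pow P 1) * (O T - (T - tm P 1)) <= 0.
  by rewrite pmulr_rle0.
have E2 : slope g (pow P (nseg P)) * (U Q T - U P T) <= 0 by rewrite pmulr_rle0.
have /eqP : intercept g (pow P 1) * (O T - (T - tm P 1)) = 0 by lra.
rewrite mulf_eq0 gt_eqF //= => /eqP w00.
have /eqP : slope g (pow P (nseg P)) * (U Q T - U P T) = 0 by lra.
rewrite mulf_eq0 gt_eqF //= => /eqP x00.
have p1N : pow P 1 = pow P (nseg P).
  have : pow P 1 <= pow P (nseg P) by apply: pow_le; rewrite ?N0 /=.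
  by rewrite le_eqVlt => /predU1P[//|/lt_N]; lra.
have pE i : (1 <= i <= nseg P)%N -> pow P i = pow P 1.
  move=> /andP[i1 iN]; apply: le_anti; rewrite {1}p1N.
  by apply/andP; split; apply: pow_le; rewrite ?i1 ?iN ?leqnn.
split.
  (* If [P] started at 0, [Q] would need on-time [T] before [finish Q < T]. *)
  rewrite lt_neqAle S0 andbT eq_sym; apply/negP => /eqP S00.
  have F0 : tm Q 1 <= finish Q by apply: tm_le.
  have := on_cumul_lip wfQ (ltW (le_lt_trans F0 finish_lt)).
  rewrite (cumul_start wfQ _ (lexx _)) (min_l (ltW finish_lt)) (min_r F0).
  by have := finish_lt; lra.
(* With a second segment, [Q] would have been on for longer than [P] by [tm P 2], as [r > 0] there.
   At the common power it would have used more than the exhausted energy. *)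
apply/eqP; rewrite eqn_leq N0 andbT leqNgt; apply/negP => N2.
have lt12 : tm P 1 < tm P 2 by apply: lt_tm; rewrite N0.
have cE c : cumul c P T = c (pow P 1) * (T - tm P 1).
  rewrite cumul_finish // -(telescope_sumr _ (_ : 1 <= (nseg P).+1)%N) //.
  rewrite mulr_sumr.
  by apply: eq_big_nat => i iN; rewrite pE.
have UO : forall s, U Q s = pow P 1 * O s.
  apply: (priced_eq_power rate wfQ p1 (ltW finish_lt)).
  rewrite (cumul_finishQ _ (ltW finish_lt)) bits_eq cE.
  have -> : U Q T = U P T by lra.
  have -> : O T = T - tm P 1 by lra.
  by rewrite cE /intercept; ring.
have : U Q (tm P 2) - U P (tm P 2) <= 0.
  by apply: energy_excess_le0; exact: N0.
rewrite UO (@cumul_segment _ _ wfP _ 1) ?N0 ?(ltW lt12) //.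
rewrite (cumul_start wfP _ (lexx _)) add0r -mulrBr pmulr_rle0 //.
have : 0 < r (tm P 2) by apply: remaining_gt0; rewrite /finish tm_lt.
by rewrite /r; lra.
Qed.

End Comparison.

(** * Lists of segments, for cutting and splicing policies *)

Section SegmentLists.
Variable R : realType.
Implicit Types (c g : R -> R) (L : seq (R * R)) (s t b : R).

(* A list of segments (length, power) used from time [s] on. *)
Fixpoint lcumul c L s t : R :=
  if L is x :: L' then c x.2 * overlap s (s + x.1) t + lcumul c L' (s + x.1) t
  else 0.

Definition llen L : R := \sum_(x <- L) x.1.

Definition lsum c L : R := \sum_(x <- L) c x.2 * x.1.

(** Lengths 0 are allowed, so that a modification may shrink a segment to nothing;
    [policy_of_positive] removes such segments. *)
Definition lvalid L : bool := all (fun x => (0 <= x.1) && (0 <= x.2)) L.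

(** The shift [i.-1] is due to policies being indexed from 1 and lists from 0. *)
Definition policy_of s L : policy R :=
  Policy (size L) (fun i => (nth (0, 0) L i.-1).2)
    (fun i => s + llen (take i.-1 L)).

Lemma llen_cons x L : llen (x :: L) = x.1 + llen L.
Proof. exact: big_cons. Qed.

Lemma lsum_cons c x L : lsum c (x :: L) = c x.2 * x.1 + lsum c L.
Proof. exact: big_cons. Qed.

Lemma llen_cat L1 L2 : llen (L1 ++ L2) = llen L1 + llen L2.
Proof. exact: big_cat. Qed.

Lemma lsum_cat c L1 L2 : lsum c (L1 ++ L2) = lsum c L1 + lsum c L2.
Proof. exact: big_cat. Qed.

Lemma llen_ge0 L : lvalid L -> 0 <= llen L.
Proof.
by move=> /allP vL; rewrite /llen big_seq sumr_ge0 // => x /vL /andP[].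
Qed.

Lemma lcumul_cat c L1 L2 s t :
  lcumul c (L1 ++ L2) s t = lcumul c L1 s t + lcumul c L2 (s + llen L1) t.
Proof.
elim: L1 s => [|x L1 IH] s /=; first by rewrite /llen big_nil addr0 add0r.
by rewrite IH llen_cons !addrA.
Qed.

Lemma lcumul_mono L s t t' : lvalid L -> t <= t' ->
  lcumul id L s t <= lcumul id L s t'.
Proof.
move=> + tt'; elim: L s => //= x L IH s /andP[/andP[x1 x2] /(IH (s + x.1)) h].
by apply: lerD h; rewrite ler_wpM2l // overlap_mono // lerDl.
Qed.

Lemma lcumul_finish c L s t : lvalid L -> s + llen L <= t ->
  lcumul c L s t = lsum c L.
Proof.
elim: L s => [|x L IH] s; first by rewrite /lsum big_nil.
rewrite llen_cons lsum_cons /= => /andP[/andP[x1 x2] vL] st.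
have L0 := llen_ge0 vL.
by rewrite IH ?overlap_ge ?lerDl // -?addrA //; lra.
Qed.

Lemma lsum_on_le L : lvalid L -> lsum (@on_indicator R) L <= llen L.
Proof.
move=> /allP vL; rewrite /lsum /llen big_seq [leRHS]big_seq.
apply: ler_sum => x /vL /andP[x1 _]; rewrite ler_piMl // /on_indicator.
by case: eqP.
Qed.

Let nonempty_segments L := [seq x <- L | x.1 != 0].

Lemma lsum_filter c L : lsum c (nonempty_segments L) = lsum c L.
Proof.
rewrite /lsum big_filter big_mkcond; apply: eq_bigr => x _.
by case: eqP => //= ->; rewrite mulr0.
Qed.

Lemma llen_filter L : llen (nonempty_segments L) = llen L.
Proof.
rewrite /llen big_filter big_mkcond; apply: eq_bigr => x _.
by case: eqP => //= ->.
Qed.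

Lemma lcumul_filter c L s t :
  lcumul c (nonempty_segments L) s t = lcumul c L s t.
Proof.
elim: L s => //= x L IH s; case: eqP => [x0|_] /=; last by rewrite IH.
by rewrite IH x0 addr0 /overlap subrr mulr0 add0r.
Qed.

Lemma cumul_policy_of c s L t : cumul c (policy_of s L) t = lcumul c L s t.
Proof.
rewrite /cumul big_add1 /=.
elim: L s => [|x L IH] s; first by rewrite big_geq.
rewrite big_nat_recl //= take0 {1 2}/llen big_nil big_cons big_nil !addr0 -IH.
congr (_ + _); apply: eq_bigr => i _.
by rewrite !llen_cons !addrA.
Qed.

(** Segments of length 0 are dropped; since [lsum g L] is positive, at least one segment remains. *)
Lemma policy_of_positive g s L : 0 <= s -> lvalid L -> 0 < lsum g L ->
  exists Q, [/\ wf_policy Q, finish Q = s + llen L &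
    forall c t, cumul c Q t = lcumul c L s t].
Proof.
move=> s0 vL gL; exists (policy_of s (nonempty_segments L)).
have pos x : x \in nonempty_segments L -> 0 < x.1 /\ 0 <= x.2.
  rewrite mem_filter => /andP[x0 /(allP vL)/andP[x1 x2]]; split => //.
  by rewrite lt_neqAle eq_sym x0.
split; last by move=> c t; rewrite cumul_policy_of lcumul_filter.
  split => /=.
  - rewrite lt0n size_eq0; apply/eqP => L0; move: gL.
    by rewrite -lsum_filter L0 /lsum big_nil ltxx.
  - by case=> // i iN; apply: (pos _ _).2; apply: mem_nth.
  - by rewrite take0 /llen big_nil addr0.
  - move=> [|i] //= iN.
    rewrite (take_nth (0, 0)) // -cats1 llen_cat addrA ltrDl.
    by rewrite /llen big_seq1; apply: (pos _ _).1; apply: mem_nth.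
by rewrite /finish /= take_size llen_filter.
Qed.

(** Segments are kept while their bits fit into [b]. The first that does not fit is shortened to
    send exactly the rest, and all later ones are dropped. *)
Lemma truncation g b L : g 0 = 0 -> (forall y, 0 <= y -> 0 <= g y) ->
  lvalid L -> 0 <= b -> b < lsum g L ->
  exists L', [/\ lvalid L', lsum g L' = b, llen L' < llen L,
    lsum (@on_indicator R) L' <= lsum (@on_indicator R) L
    & forall s t, lcumul id L' s t <= lcumul id L s t].
Proof.
move=> g0 gge0; elim: L b => [|x L IH] b.
  by rewrite /lsum big_nil => _; case: ltP => // ? ?; lra.
rewrite lsum_cons /= => /andP[/andP[x1 x2] vL] b0 bL.
have L0 := llen_ge0 vL.
have lcum0 s t : 0 <= lcumul id L s t.
  elim: L vL s {IH bL L0} => //= y L IH /andP[/andP[y1 y2] /IH{}IH] s.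
  by rewrite addr_ge0 // mulr_ge0 // overlap_ge0 // lerDl.
have on0 : 0 <= lsum (@on_indicator R) L.
  rewrite /lsum big_seq sumr_ge0 // => y /(allP vL)/andP[y1 _].
  by rewrite mulr_ge0 // /on_indicator ler0n.
have [bx|xb] := ltP b (g x.2 * x.1).
  have gx : 0 < g x.2.
    rewrite lt_neqAle gge0 // andbT; apply/eqP => gx.
    by move: bx; rewrite -gx mul0r ltNge b0.
  have bgx : b / g x.2 < x.1 by rewrite ltr_pdivrMr // mulrC.
  have bg0 : 0 <= b / g x.2 by rewrite divr_ge0 // ltW.
  exists [:: (b / g x.2, x.2)]; split => /=.
  - by rewrite bg0 x2.
  - by rewrite /lsum big_seq1 /= mulrC divfK // gt_eqF.
  - by rewrite /llen big_seq1 big_cons /= -/(llen L); lra.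
  - rewrite !lsum_cons {1}/lsum big_nil addr0 /=; apply: ler_wpDr => //.
    by rewrite ler_wpM2l ?(ltW bgx) // /on_indicator ler0n.
  - move=> s t; rewrite addr0; apply: ler_wpDr => //; rewrite ler_wpM2l //.
    by rewrite /overlap lerD2r le_min !ge_min lerD2l (ltW bgx) lexx orbT.
have [||L' [vL' bL' lL' oL' cL']] := IH (b - g x.2 * x.1) vL;
  [lra|lra|].
exists (x :: L'); split => /=.
- by rewrite x1 x2.
- by rewrite lsum_cons bL'; lra.
- by rewrite !llen_cons ltrD2l.
- by rewrite !lsum_cons lerD2l.
- by move=> s t; rewrite lerD2l.
Qed.

Definition seglist (P : policy R) (i j : nat) : seq (R * R) :=
  [seq (tm P k.+1 - tm P k, pow P k) | k <- index_iota i j].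

Lemma seglist_cons P i j : (i < j)%N ->
  seglist P i j = (tm P i.+1 - tm P i, pow P i) :: seglist P i.+1 j.
Proof. by move=> ij; rewrite /seglist /index_iota -(subnSK ij). Qed.

Lemma lsum_seglist c P i j : lsum c (seglist P i j) =
  \sum_(i <= k < j) c (pow P k) * (tm P k.+1 - tm P k).
Proof. by rewrite /lsum big_map. Qed.

Lemma llen_seglist P i j : (i <= j)%N -> llen (seglist P i j) = tm P j - tm P i.
Proof. by move=> ij; rewrite /llen big_map /= telescope_sumr. Qed.

Lemma lcumul_seglist c P i j t : (i <= j)%N ->
  lcumul c (seglist P i j) (tm P i) t =
  \sum_(i <= k < j) c (pow P k) * overlap (tm P k) (tm P k.+1) t.
Proof.
move=> ij; move Dn : (j - i)%N => n; elim: n i ij Dn => [|n IH] i ij Dn.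
  have -> : i = j by lia.
  by rewrite big_geq // /seglist /index_iota subnn.
have lt_ij : (i < j)%N by lia.
rewrite seglist_cons //= subrKC IH; [|exact: lt_ij|by rewrite subnS Dn].
by rewrite [RHS]big_ltn.
Qed.

Lemma lvalid_seglist P i j :
  wf_policy P -> (1 <= i)%N -> (j <= (nseg P).+1)%N -> lvalid (seglist P i j).
Proof.
move=> wfP i1 jN; have [_ p0 _ _] := wfP; apply/allP => x /mapP[k].
rewrite mem_index_iota => kij ->; rewrite /= subr_ge0 tm_step ?p0 //; lia.
Qed.

End SegmentLists.

(** * Necessity of (1)-(4): local modifications of an optimal policy *)

Lemma pos_lower_bound (R : realType) (a b c d : R) :
  0 < a -> 0 < b -> 0 < c -> 0 < d ->
  exists e, [/\ 0 < e, e <= a, e <= b, e <= c & e <= d].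
Proof.
move=> a0 b0 c0 d0; exists (Num.min (Num.min a b) (Num.min c d)).
by rewrite !lt_min !ge_min !lexx a0 b0 c0 d0 !orbT.
Qed.

Section Optimal.
Variables (R : realType) (g : R -> R) (tau En : nat -> R) (Gamma0 B0 : R).
Variable P : policy R.
Hypotheses (rate : rate_function g) (arr : arrival_process tau En).
Hypotheses (Gamma0_gt0 : 0 < Gamma0) (B0_gt0 : 0 < B0).
Hypothesis opt : optimal g tau En Gamma0 B0 P.
Hypothesis std : standard_breakpoints tau En P.
Local Notation E := (harvested tau En).
Local Notation Em := (harvested_before tau En).
Local Notation T := (finish P).
Local Notation N := (nseg P).
Local Notation U := (cumul id P).

Lemma opt_wf : wf_policy P.
Proof. by case: opt => -[]. Qed.

Let wfP := opt_wf.

Lemma opt_pos i : (1 <= i <= N)%N -> 0 < pow P i.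
Proof. by case: opt => _ + _; apply. Qed.

Lemma opt_energy t : 0 <= t -> U t <= E t.
Proof. by case: opt => -[_ _ ef _] _ _; exact: cumul_le_harvested. Qed.

Lemma opt_energy_before t : 0 <= t -> U t <= Em t.
Proof. by case: opt => -[_ _ ef _] _ _; exact: cumul_le_harvested_before. Qed.

Lemma opt_bits : cumul g P T = B0.
Proof. by case: opt => -[_ <- _ _] _ _; rewrite bits_sentE // rate_0. Qed.

Lemma opt_duration : T - tm P 1 <= Gamma0.
Proof.
case: opt => -[_ _ _ +] _ _; rewrite on_timeE // on_cumul_without_breaks //.
  by rewrite overlap_ge // tm_le //; case: wfP.
exact: opt_pos.
Qed.

(** Otherwise [truncation] would give a feasible policy finishing strictly before [T]. *)
Lemma no_better s L : 0 <= s -> lvalid L ->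
  (forall t, 0 <= t -> lcumul id L s t <= E t) ->
  lsum (@on_indicator R) L <= Gamma0 -> s + llen L <= T ->
  lsum g L <= B0.
Proof.
move=> s0 vL eL oL LT; rewrite leNgt; apply/negP => BL.
have [L' [vL' bL' lL' oL' cL']] :=
  truncation (rate_0 rate) (rate_ge0 rate) vL (ltW B0_gt0) BL.
have [|Q [wfQ fQ cQ]] := @policy_of_positive _ g s L' s0 vL'.
  by rewrite bL'.
have cumQ c : cumul c Q (finish Q) = lsum c L' by rewrite cQ fQ lcumul_finish.
have : T <= finish Q.
  case: opt => _ _; apply; split => //.
  - by rewrite bits_sentE ?(rate_0 rate) // cumQ.
  - move=> t t0 _; rewrite energy_usedE // cQ.
    exact: le_trans (cL' s t) (eL t t0).
  - by rewrite on_timeE // cumQ (le_trans oL').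
rewrite fQ; lra.
Qed.

(* [M], started at [s], replaces the segments [i], ..., [j - 1]; since energy
   use is nondecreasing, the constraint at [t] may be checked at a later [v]. *)
Lemma no_better_segments i j s M :
  (1 <= i)%N -> (i <= j)%N -> (j <= N.+1)%N ->
  0 <= s -> (i = 1%N \/ s = tm P i) -> lvalid M -> s + llen M = tm P j ->
  llen M <= Gamma0 - (T - tm P 1) + (tm P j - tm P i) ->
  let S t := \sum_(i <= k < j) pow P k * overlap (tm P k) (tm P k.+1) t in
  (forall t, 0 <= t -> lcumul id M s t <= S t \/
     exists2 v, t <= v & U v + (lcumul id M s v - S v) <= E t) ->
  lsum g M <= \sum_(i <= k < j) g (pow P k) * (tm P k.+1 - tm P k).
Proof.
move=> i1 ij jN s0 si vM sM lM S eM.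
pose L := seglist P 1 i ++ M ++ seglist P j N.+1.
(* The start of the whole list: [s] when [i = 1], and [tm P 1] when [s = tm P i]. *)
pose s' := s - (tm P i - tm P 1).
have vL : lvalid L.
  rewrite /L /lvalid !all_cat; apply/and3P; split => //.
    by apply: lvalid_seglist => //; apply: leq_trans jN.
  by apply: lvalid_seglist => //; apply: leq_trans ij.
have s'0 : 0 <= s'.
  rewrite /s'; case: si => [->|->]; first by lra.
  by have [_ _ + _] := wfP; lra.
have llen1 : llen (seglist P 1 i) = tm P i - tm P 1 by exact: llen_seglist.
have pre t : lcumul id (seglist P 1 i) s' t =
    \sum_(1 <= k < i) pow P k * overlap (tm P k) (tm P k.+1) t.
  case: si => [->|si]; first by rewrite big_geq // /seglist /index_iota.
  rewrite (_ : s' = tm P 1); last by rewrite /s' si; lra.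
  exact: lcumul_seglist.
have sum3 (F : nat -> R) : \sum_(1 <= k < N.+1) F k = \sum_(1 <= k < i) F k +
    (\sum_(i <= k < j) F k + \sum_(j <= k < N.+1) F k).
  rewrite -[X in _ + X](big_cat_nat ij jN) /=.
  by rewrite -(big_cat_nat i1 (leq_trans ij jN)).
have cL t : lcumul id L s' t = U t + (lcumul id M s t - S t).
  rewrite /L !lcumul_cat pre llen1 (_ : s' + _ = s); last by rewrite /s'; lra.
  rewrite sM lcumul_seglist // /cumul /S.
  by rewrite sum3; lra.
have bP : B0 = \sum_(1 <= k < i) g (pow P k) * (tm P k.+1 - tm P k) +
  (\sum_(i <= k < j) g (pow P k) * (tm P k.+1 - tm P k) +
   \sum_(j <= k < N.+1) g (pow P k) * (tm P k.+1 - tm P k)).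
  by rewrite -opt_bits cumul_finish // sum3.
have llenL : llen L = tm P i - tm P 1 + llen M + (T - tm P j).
  by rewrite /L !llen_cat llen1 [llen (seglist P j _)]llen_seglist // addrA.
have : lsum g L <= B0.
  apply: (@no_better s') => //.
  - move=> t t0; have [le|[v tv le]] := eM t t0.
      by apply: le_trans (opt_energy t0); rewrite cL; lra.
    by apply: (le_trans _ le); rewrite -cL; exact: lcumul_mono.
  - by apply: le_trans (lsum_on_le vL) _; rewrite llenL; lra.
  - by rewrite llenL /s'; lra.
rewrite /L !lsum_cat !lsum_seglist bP; lra.
Qed.

(** If the power dropped, both segments could run at their average [m]. This only delays the use of
    energy, and the strict tangent at [m] shows that it sends more bits. *)
Lemma opt_monotone i : (1 <= i < N)%N -> pow P i <= pow P i.+1.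
Proof.
move=> iN; rewrite leNgt; apply/negP => lt_p.
have [_ _ S0 lt_tm] := wfP.
have p1 : 0 < pow P i by apply: opt_pos; move: iN; clear; lia.
have p2 : 0 < pow P i.+1 by apply: opt_pos; move: iN; clear; lia.
have l1 : tm P i < tm P i.+1 by apply: lt_tm; move: iN; clear; lia.
have l2 : tm P i.+1 < tm P i.+2 by apply: lt_tm; move: iN; clear; lia.
have si : tm P 1 <= tm P i by apply: tm_le => //; move: iN; clear; lia.
pose w := tm P i.+2 - tm P i.
pose m := (pow P i * (tm P i.+1 - tm P i) +
           pow P i.+1 * (tm P i.+2 - tm P i.+1)) / w.
have w0 : 0 < w by rewrite /w; lra.
have mw : m * w = pow P i * (tm P i.+1 - tm P i) +
           pow P i.+1 * (tm P i.+2 - tm P i.+1) by rewrite divfK // gt_eqF.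
have m1 : m < pow P i by rewrite -(ltr_pM2r w0) mw /w; nra.
have m2 : pow P i.+1 < m by rewrite -(ltr_pM2r w0) mw /w; nra.
have m0 : 0 < m by lra.
have sum2 (F : nat -> R) : \sum_(i <= k < i.+2) F k = F i + F i.+1.
  by rewrite big_nat_recr ?big_nat1 //= leqnSn.
have lt_bits : g (pow P i) * (tm P i.+1 - tm P i) +
    g (pow P i.+1) * (tm P i.+2 - tm P i.+1) < g m * w.
  have lt1 := slopeP rate m0 (ltW p1) (negbT (gt_eqF m1)).
  have lt2 := slopeP rate m0 (ltW p2) (negbT (lt_eqF m2)).
  rewrite -(ltr_pM2r (_ : 0 < tm P i.+1 - tm P i)) in lt1; last by lra.
  rewrite -(ltr_pM2r (_ : 0 < tm P i.+2 - tm P i.+1)) in lt2; last by lra.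
  by have := mw; have := congr1 ( *%R (slope g m)) mw; rewrite /w; lra.
suff : g m * w <= g (pow P i) * (tm P i.+1 - tm P i) +
    g (pow P i.+1) * (tm P i.+2 - tm P i.+1) by rewrite leNgt lt_bits.
have := @no_better_segments i i.+2 (tm P i) [:: (w, m)].
rewrite /lsum /llen /lvalid !big_seq1 /= sum2 (ltW w0) (ltW m0).
apply => //; [by case/andP: iN|by rewrite -addn2 leq_addr|by case/andP: iN
  |by lra|by right|by rewrite /w; lra
  |by rewrite /w; have := opt_duration; lra|].
move=> t t0; left; rewrite addr0 sum2 {1}/w addrC subrK.
have [h1|h1] := leP t (tm P i).
  by rewrite !overlap_le //; lra.
have [h2|h2] := leP (tm P i.+2) t.
  by rewrite !overlap_ge //; rewrite -/w; lra.
have [h3|h3] := leP (tm P i.+1) t.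
  rewrite (overlap_mid h3 (ltW h2)) (overlap_mid (ltW h1) (ltW h2)).
  rewrite (overlap_ge (ltW l1) h3).
  suff : (m - pow P i.+1) * (tm P i.+2 - t) >= 0.
    by move: mw; rewrite /w; lra.
  by rewrite mulr_ge0 //; lra.
rewrite (overlap_mid (ltW h1) (ltW h2)) (overlap_mid (ltW h1) (ltW h3)).
rewrite (overlap_le (ltW l2) (ltW h3)).
by rewrite mulr0 addr0 ler_wpM2r //; lra.
Qed.

Lemma opt_boundary_exhausted i : (1 <= i < N)%N ->
  U (tm P i.+1) = Em (tm P i.+1).
Proof.
move=> iN; have [_ _ S0 lt_tm] := wfP.
have p1 : 0 < pow P i by apply: opt_pos; move: iN; clear; lia.
have p2 : 0 < pow P i.+1 by apply: opt_pos; move: iN; clear; lia.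
have l1 : tm P i < tm P i.+1 by apply: lt_tm; move: iN; clear; lia.
have l2 : tm P i.+1 < tm P i.+2 by apply: lt_tm; move: iN; clear; lia.
have si : tm P 1 <= tm P i by apply: tm_le => //; move: iN; clear; lia.
(* A breakpoint without change of power is present by convention only, and the convention includes
   exhaustion. *)
have := opt_monotone iN; rewrite le_eqVlt => /predU1P[eq_p|lt_p].
  have [|k _] := std.2 i.+1 _ eq_p; first by move: iN; clear; lia.
  by rewrite /exhausted energy_usedE.
apply: le_anti; rewrite opt_energy_before /=; last by lra.
rewrite leNgt; apply/negP => slack.
have [s0 s0b Es0] := harvested_before_left arr (tm P i.+1).
(* The powers will be averaged over the window of radius [d] around the breakpoint. It must fit into
   both segments and start no earlier than [s0], and the use of [P] in its second half must not
   exceed the slack. *)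
have sl0 : 0 < (Em (tm P i.+1) - U (tm P i.+1)) / pow P i.+1.
  by rewrite divr_gt0 // subr_gt0.
have [a1 a2 a3] : [/\ 0 < tm P i.+1 - tm P i, 0 < tm P i.+2 - tm P i.+1
  & 0 < tm P i.+1 - s0] by split; lra.
have [d [d0 d1 d2 d3 d4]] := pos_lower_bound a1 a2 sl0 a3.
rewrite ler_pdivlMr // in d3.
pose m := (pow P i + pow P i.+1) / 2.
have mE : m + m = pow P i + pow P i.+1 by rewrite /m; lra.
have m0 : 0 < m by lra.
have sum2 (F : nat -> R) : \sum_(i <= k < i.+2) F k = F i + F i.+1.
  by rewrite big_nat_recr ?big_nat1 //= leqnSn.
have gm : g (pow P i) + g (pow P i.+1) < g m + g m.
  have m1 : pow P i != m by rewrite lt_eqF //; lra.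
  have m2 : pow P i.+1 != m by rewrite gt_eqF //; lra.
  have lt1 := slopeP rate m0 (ltW p1) m1.
  have lt2 := slopeP rate m0 (ltW p2) m2.
  by have := congr1 ( *%R (slope g m)) mE; lra.
have gmd : (g (pow P i) + g (pow P i.+1)) * d < (g m + g m) * d.
  by rewrite ltr_pM2r.
pose M := [:: (tm P i.+1 - tm P i - d, pow P i); (2 * d, m);
              (tm P i.+2 - tm P i.+1 - d, pow P i.+1)].
suff : lsum g M <= \sum_(i <= k < i.+2) g (pow P k) * (tm P k.+1 - tm P k).
  by rewrite sum2 /lsum !big_cons big_nil /=; lra.
have ME t : lcumul id M (tm P i) t =
    pow P i * overlap (tm P i) (tm P i.+1 - d) t +
    m * overlap (tm P i.+1 - d) (tm P i.+1 + d) t +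
    pow P i.+1 * overlap (tm P i.+1 + d) (tm P i.+2) t.
  rewrite /= addr0 addrA.
  rewrite (_ : tm P i + (tm P i.+1 - tm P i - d) = tm P i.+1 - d); last by lra.
  rewrite (_ : tm P i.+1 - d + 2 * d = tm P i.+1 + d); last by lra.
  by rewrite (_ : _ + (_ - _ - d) = tm P i.+2); last by lra.
have Mr t : tm P i.+1 + d <= t -> lcumul id M (tm P i) t =
    \sum_(i <= k < i.+2) pow P k * overlap (tm P k) (tm P k.+1) t.
  move=> dt; rewrite ME sum2 /overlap.
  have [-> -> -> ->] : [/\ Num.min (tm P i.+1 - d) t = tm P i.+1 - d,
     Num.min (tm P i.+1 + d) t = tm P i.+1 + d, Num.min (tm P i) t = tm P i
     & Num.min (tm P i.+1) t = tm P i.+1] by split; apply: min_l; lra.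
  by have := congr1 ( *%R d) mE; lra.
have vM : lvalid M.
  apply/allP => x; rewrite !inE => /or3P[]/eqP -> /=;
    by apply/andP; split; lra.
apply: (@no_better_segments _ _ (tm P i)) => //.
- by case/andP: iN.
- by rewrite -addn2 leq_addr.
- by case/andP: iN.
- by lra.
- by right.
- by rewrite /llen !big_cons big_nil /=; lra.
- by rewrite /llen !big_cons big_nil /=; have := opt_duration; lra.
move=> t t0; have [dt|td] := leP (tm P i.+1 + d) t; first by left; rewrite Mr.
have [bt|tb] := leP t (tm P i.+1 - d).
  have [tb' tbd tc] : [/\ t <= tm P i.+1, t <= tm P i.+1 + d & t <= tm P i.+2].
    by split; lra.
  left; rewrite ME sum2 /overlap (min_r bt) (min_r tb') (min_r tbd) (min_r tc).
  by lra.
(* Inside the window the check is made at its end, where the modified policy has used as much energy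
   as [P]. *)
right; exists (tm P i.+1 + d); first exact: ltW.
rewrite Mr // subrr addr0.
rewrite (@cumul_segment _ _ wfP _ i.+1) //; try lra; last by case/andP: iN.
have := Es0 t ltac:(lra); rewrite /= ; lra.
Qed.

Lemma opt_end_exhausted : U T = Em T.
Proof.
have [N0 _ S0 lt_tm] := wfP.
have p0 : 0 < pow P N by apply: opt_pos; rewrite N0 /=.
have l0 : tm P N < T by apply: lt_tm; rewrite N0 /=.
have sN : tm P 1 <= tm P N by apply: tm_le.
apply: le_anti; rewrite opt_energy_before /=; last by lra.
rewrite leNgt; apply/negP => slack.
have [s0 s0b Es0] := harvested_before_left arr T.
have [a1 a2] : 0 < T - tm P N /\ 0 < T - s0 by split; lra.
have [d [d0 d1 d2 _ _]] := pos_lower_bound a1 a2 ltr01 ltr01.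
pose e := (Em T - U T) / d.
have e0 : 0 < e by rewrite divr_gt0 // subr_gt0.
have ed : e * d = Em T - U T by rewrite divfK // gt_eqF.
have ge : g (pow P N) * d < g (pow P N + e) * d.
  by rewrite ltr_pM2r // rate_lt //; lra.
pose M := [:: (T - tm P N - d, pow P N); (d, pow P N + e)].
suff : lsum g M <= \sum_(N <= k < N.+1) g (pow P k) * (tm P k.+1 - tm P k).
  by rewrite big_nat1 /lsum !big_cons big_nil /= -/T; lra.
have ME t : lcumul id M (tm P N) t =
    pow P N * overlap (tm P N) (T - d) t + (pow P N + e) * overlap (T - d) T t.
  rewrite /= addr0.
  rewrite (_ : tm P N + (T - tm P N - d) = T - d); last by lra.
  by rewrite subrK.
have vM : lvalid M.
  by apply/allP => x; rewrite !inE => /orP[]/eqP -> /=; apply/andP; split; lra.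
apply: (@no_better_segments _ _ (tm P N)) => //; rewrite -/T.
- by lra.
- by right.
- by rewrite /llen !big_cons big_nil /=; lra.
- by rewrite /llen !big_cons big_nil /=; have := opt_duration; lra.
move=> t t0; rewrite !big_nat1 -/T; have [dt|td] := leP t (T - d).
  have tT : t <= T by lra.
  by left; rewrite ME /overlap (min_r dt) (min_r tT) subrr mulr0 addr0.
right; exists (Num.max T t); first by rewrite le_max lexx orbT.
have Tm : T <= Num.max T t by rewrite le_max lexx.
rewrite big_nat1 -/T ME !overlap_ge //; try lra.
rewrite cumul_finish // -(cumul_finish wfP id (lexx _)).
by have := Es0 t ltac:(lra); lra.
Qed.

(** With on-time to spare, the first stretch [d] could be replaced by one of length [2 * d] at half
    the power, started [d] earlier. The energy is the same, and the positive intercept gives more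
    bits. *)
Lemma opt_late_start : 0 < tm P 1 -> T - tm P 1 = Gamma0.
Proof.
move=> S0; have [N0 _ _ lt_tm] := wfP.
have p0 : 0 < pow P 1 by apply: opt_pos; rewrite N0.
have l0 : tm P 1 < tm P 2 by apply: lt_tm; rewrite N0.
apply: le_anti; rewrite opt_duration leNgt; apply/negP => slack.
have [a1 a2] : 0 < tm P 2 - tm P 1 /\ 0 < Gamma0 - (T - tm P 1) by split; lra.
(* The last bound makes [pow P 1 * d] at most the very first arrival, which is available from time
   0. *)
have [d [d0 d1 d2 d3 d4]] :=
  pos_lower_bound S0 a1 a2 (divr_gt0 (arrival_gt0 arr 0) p0).
rewrite ler_pdivlMr // in d4.
have gh : g (pow P 1) * d < g (pow P 1 / 2) * (2 * d).
  have h0 : 0 < pow P 1 / 2 by lra.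
  have h1 : pow P 1 != pow P 1 / 2 by rewrite gt_eqF //; lra.
  have lt1 := slopeP rate h0 (ltW p0) h1.
  have := intercept_gt0 rate h0; rewrite /intercept => ic.
  by rewrite mulrA ltr_pM2r //; lra.
pose M := [:: (2 * d, pow P 1 / 2); (tm P 2 - tm P 1 - d, pow P 1)].
suff : lsum g M <= \sum_(1 <= k < 2) g (pow P k) * (tm P k.+1 - tm P k).
  by rewrite big_nat1 /lsum !big_cons big_nil /=; lra.
have ME t : lcumul id M (tm P 1 - d) t =
    pow P 1 / 2 * overlap (tm P 1 - d) (tm P 1 + d) t +
    pow P 1 * overlap (tm P 1 + d) (tm P 2) t.
  rewrite /= addr0.
  rewrite (_ : tm P 1 - d + 2 * d = tm P 1 + d); last by lra.
  by rewrite (_ : _ + (_ - _ - d) = tm P 2); last by lra.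
have vM : lvalid M.
  by apply/allP => x; rewrite !inE => /orP[]/eqP -> /=; apply/andP; split; lra.
have Mr t : tm P 1 + d <= t -> lcumul id M (tm P 1 - d) t =
    pow P 1 * overlap (tm P 1) (tm P 2) t.
  move=> dt; rewrite ME /overlap.
  have [-> -> ->] : [/\ Num.min (tm P 1 - d) t = tm P 1 - d,
     Num.min (tm P 1 + d) t = tm P 1 + d & Num.min (tm P 1) t = tm P 1].
    by split; apply: min_l; lra.
  by lra.
apply: (@no_better_segments _ _ (tm P 1 - d)) => //.
- by lra.
- by left.
- by rewrite /llen !big_cons big_nil /=; lra.
- by rewrite /llen !big_cons big_nil /=; lra.
move=> t t0; rewrite !big_nat1; have [dt|td] := leP (tm P 1 + d) t.
  by left; rewrite Mr.
right; exists (tm P 1 + d); first exact: ltW.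
rewrite big_nat1 Mr // subrr addr0.
rewrite (@cumul_segment _ _ wfP _ 1) ?N0 //; try lra.
rewrite cumul_start //.
by have := harvested_ge_En0 arr t0; rewrite /=; lra.
Qed.

(** The energy is exhausted at the breakpoint, so without an arrival there the next segment would
    have nothing to use. *)
Lemma opt_boundary_arrival i : (1 <= i < N)%N ->
  exists j, tm P i.+1 = tau j.
Proof.
move=> iN; have [_ _ S0 lt_tm] := wfP.
have p2 : 0 < pow P i.+1 by apply: opt_pos; case/andP: iN.
have l2 : tm P i.+1 < tm P i.+2 by apply: lt_tm; case/andP: iN.
have si : tm P 1 <= tm P i.+1 by apply: tm_le => //; apply: ltnW; case/andP: iN.
apply: contrapT => noarr.
have [s0 bs0 Es0] :=
  harvested_right_nonarrival arr (fun j e => noarr (ex_intro _ j e)).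
have [a1 a2] : 0 < (tm P i.+2 - tm P i.+1) / 2 /\ 0 < (s0 - tm P i.+1) / 2.
  by split; lra.
have [d [d0 d1 d2 _ _]] := pos_lower_bound a1 a2 ltr01 ltr01.
have b0 : 0 <= tm P i.+1 + d by lra.
have bs : tm P i.+1 + d < s0 by lra.
have := le_trans (opt_energy b0) (Es0 _ bs).
rewrite (@cumul_segment _ _ wfP id i.+1); [|by case/andP: iN|lra|lra].
rewrite (opt_boundary_exhausted iN) /=.
by have := mulr_gt0 p2 d0; lra.
Qed.

End Optimal.

(** * Necessity of (5): the constant-power policy and its epoch tau_q *)

Lemma uniform_gap (R : realType) (a b : nat -> R) n :
  (forall k, (k <= n)%N -> a k < b k) ->
  exists2 e, 0 < e & forall k, (k <= n)%N -> a k + e <= b k.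
Proof.
elim: n => [|n IH] ab.
  exists (b 0%N - a 0%N); first by rewrite subr_gt0 ab.
  by move=> k; rewrite leqn0 => /eqP ->; lra.
have [k kn|e e0 abe] := IH; first by apply: ab; exact: leqW.
have abn := ab n.+1 (leqnn _).
exists (Num.min e (b n.+1 - a n.+1)); first by rewrite lt_min e0 subr_gt0.
move=> k; rewrite leq_eqVlt => /predU1P[->|/abe abk].
  by case: (leP e (b n.+1 - a n.+1)); lra.
by case: (leP e (b n.+1 - a n.+1)); lra.
Qed.

Lemma find_segment (R : realType) (P : policy R) t : wf_policy P ->
  tm P 1 <= t -> t <= finish P ->
  exists k, [/\ (1 <= k <= nseg P)%N, tm P k <= t & t <= tm P k.+1].
Proof.
move=> [N0 _ _ _]; rewrite /finish; elim: (nseg P) N0 => // N IH _ St.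
move=> tN1; have [tN|Nt] := leP t (tm P N.+1); last first.
  by exists N.+1; rewrite leqnn ltW.
have [N0|N0] := posnP N; first by exists 1%N; rewrite N0 /= in tN1 *.
have [k [/andP[k1 kN] kt tk]] := IH N0 St tN.
by exists k; split => //; rewrite k1 leqW.
Qed.

Section ConstantPolicy.
Variables (R : realType) (p S D : R).
Hypotheses (p_ge0 : 0 <= p) (S_ge0 : 0 <= S) (D_gt0 : 0 < D).

Lemma wf_constant_policy : wf_policy (constant_policy p S D).
Proof. by split => //=; case=> [|[|i]] //= _; rewrite ltrDl. Qed.

Lemma cumul_constant_policy c t :
  cumul c (constant_policy p S D) t = c p * overlap S (S + D) t.
Proof. by rewrite /cumul big_nat1. Qed.

End ConstantPolicy.

Section TauQ.
Variables (R : realType) (g : R -> R) (tau En : nat -> R) (Gamma0 B0 : R).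
Variables (n q : nat) (D S : R).
Hypotheses (rate : rate_function g) (arr : arrival_process tau En).
Hypotheses (Gamma0_gt0 : 0 < Gamma0) (B0_gt0 : 0 < B0).
Local Notation E := (harvested tau En).
Local Notation Em := (harvested_before tau En).
Let p := E (tau n) / D.
Hypothesis sufficient_n : is_first_sufficient_epoch g tau En Gamma0 B0 n.
Hypotheses (D_gt0 : 0 < D) (bitsD : D * g p = B0).
Hypothesis startS : is_earliest_start tau En p D S.
Hypothesis first_q :
  is_first_exhaustion_epoch tau En (constant_policy p S D) q.
Local Notation C := (constant_policy p S D).

Let S_ge0 : 0 <= S.
Proof. by case: startS. Qed.

Let p_gt0 : 0 < p.
Proof. by rewrite divr_gt0 ?harvested_tau_gt0. Qed.

Let pD : p * D = E (tau n).
Proof. by rewrite divfK // gt_eqF. Qed.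

Let wfC : wf_policy C.
Proof. exact: wf_constant_policy (ltW p_gt0) S_ge0 D_gt0. Qed.

Let feasC : energy_feasible tau En C.
Proof. by case: startS. Qed.

(** On-time [Gamma0] suffices with the energy of tau_n, and by [perspective_lt] a longer on-time
    would send more than [B0]. *)
Lemma duration_le : D <= Gamma0.
Proof.
rewrite leNgt; apply/negP => lt_D.
have := perspective_lt rate (harvested_tau_gt0 arr n) Gamma0_gt0 lt_D.
by rewrite -/p bitsD ltNge sufficient_n.1.
Qed.

Lemma constant_feasible : feasible g tau En Gamma0 B0 C.
Proof.
have finE : overlap S (S + D) (finish C) = D.
  by rewrite overlap_ge ?lerDl ?(ltW D_gt0) // addrC addKr.
split=> //.
- by rewrite bits_sentE ?(rate_0 rate) // cumul_constant_policy finE mulrC.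
- rewrite on_timeE // cumul_constant_policy finE /on_indicator gt_eqF //.
  by rewrite mul1r duration_le.
Qed.

(** The constant-power policy uses E(tau_n) in total, so the [n]-th arrival cannot come after its
    end. *)
Lemma tau_n_le : tau n <= S + D.
Proof.
rewrite leNgt; apply/negP => /(harvested_lt_tau arr).
have SD0 : 0 <= S + D by rewrite addr_ge0 // ltW.
have := cumul_le_harvested arr wfC feasC SD0.
rewrite cumul_constant_policy overlap_ge ?lerDl ?(ltW D_gt0) //= addrC addKr pD.
by move=> h1 h2; have := le_lt_trans h1 h2; rewrite ltxx.
Qed.

Lemma cumulC_mid t : S <= t -> t <= S + D -> cumul id C t = p * (t - S).
Proof. by move=> St tD; rewrite cumul_constant_policy overlap_mid. Qed.

Lemma line_le_harvested_before t : 0 <= t -> t <= S + D -> p * (t - S) <= Em t.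
Proof.
move=> t0 tD; have [tS|St] := leP t S.
  apply: le_trans (harvested_before_ge0 arr t).
  by rewrite pmulr_rle0 // subr_le0.
rewrite -(cumulC_mid (ltW St) tD); exact: cumul_le_harvested_before.
Qed.

Lemma first_q_gt0 : 0 < S -> (0 < q)%N.
Proof.
move=> S0; rewrite lt0n; apply/eqP => q0.
by have [+ _ _] := first_q; rewrite q0 (arrival_0 arr) leNgt S0.
Qed.

(** Since E(0^-) = 0, time 0 itself counts as an exhaustion epoch. *)
Lemma first_q_eq0 : S = 0 -> q = 0%N.
Proof.
move=> S0; have [_ _ min] := first_q; apply/eqP; rewrite -leqn0; apply: min.
  by rewrite (arrival_0 arr) /= S0.
rewrite /exhausted (arrival_0 arr) energy_usedE // (harvested_before_0 arr).
by rewrite cumul_start //= S0.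
Qed.

(* Otherwise the start could be advanced. *)
Lemma first_q_le : 0 < S -> (q <= n)%N.
Proof.
move=> S0; rewrite leqNgt; apply/negP => nq.
have slack k : (k <= n)%N -> p * (tau k - S) < Em (tau k).
  move=> kn; have kD : tau k <= S + D.
    by apply: le_trans tau_n_le; rewrite (tau_mono arr).
  rewrite lt_neqAle line_le_harvested_before ?(tau_ge0 arr) // andbT.
  apply/eqP => ex; have [kS|Sk] := ltP (tau k) S.
    have : p * (tau k - S) < 0 by rewrite pmulr_rlt0 // subr_lt0.
    by rewrite ex ltNge harvested_before_ge0.
  have [_ _ /(_ k Sk)] := first_q.
  rewrite /exhausted energy_usedE // cumulC_mid // => /(_ ex).
  by rewrite leqNgt (leq_ltn_trans kn nq).
(* Finitely many strict inequalities leave a common margin [e], and starting [d] earlier raises the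
   line by [p * d <= e]. *)
have [e e0 gap] := uniform_gap slack.
pose d := Num.min (e / p) S.
have d0 : 0 < d by rewrite lt_min S0 divr_gt0.
have dS : d <= S by rewrite ge_min lexx orbT.
have pd : p * d <= e by rewrite mulrC -ler_pdivlMr // ge_min lexx.
have [_ _ min] := startS.
suff : S <= S - d by lra.
have Sd0 : 0 <= S - d by rewrite subr_ge0.
apply: min => // t t0 _.
rewrite energy_usedE; last exact: wf_constant_policy (ltW p_gt0) Sd0 D_gt0.
rewrite cumul_constant_policy /=.
have SdD : S - d <= S - d + D by rewrite lerDl ltW.
(* From tau_n on, the total energy [p * D] is available; before it, the next arrival has index at
   most [n] and the margin applies there. *)
have [nt|tn] := leP (tau n) t.
  apply: le_trans (harvested_mono arr nt); rewrite -pD ler_pM2l //.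
  rewrite /overlap.
  by case: (leP (S - d + D) t); case: (leP (S - d) t) => *; lra.
have [m [tm -> min_m]] := harvested_next arr t.
have Em0 := harvested_before_ge0 arr (tau m).
have [tS|St] := leP t (S - d); first by rewrite overlap_le // mulr0.
apply: (@le_trans _ _ (p * (t - (S - d)))).
  rewrite ler_pM2l // /overlap.
  by case: (leP (S - d + D) t); case: (leP (S - d) t) => *; lra.
apply: le_trans (gap m (min_m _ tn)).
have : p * t <= p * tau m by rewrite ler_pM2l // ltW.
lra.
Qed.

Variable P : policy R.
Hypothesis opt : optimal g tau En Gamma0 B0 P.
Hypothesis std : standard_breakpoints tau En P.
Local Notation T := (finish P).
Local Notation N := (nseg P).
Local Notation U := (cumul id P).

Let wfP : wf_policy P.
Proof. exact: opt_wf opt. Qed.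

Lemma opt_finish_le : T <= S + D.
Proof. by case: opt => _ _ /(_ _ constant_feasible). Qed.

(** If [P] starts after 0, it lasts [Gamma0 >= D] and yet ends by [S + D]. *)
Lemma opt_start_le : tm P 1 <= S.
Proof.
have [_ _ + _] := wfP; rewrite le_eqVlt => /predU1P[<-//|].
move=> /(opt_late_start rate arr B0_gt0 opt).
by have := opt_finish_le; have := duration_le; lra.
Qed.

Lemma opt_breakpoint_exhausted i : (2 <= i <= N.+1)%N ->
  U (tm P i) = Em (tm P i).
Proof.
case: i => // i /andP[i1]; rewrite ltnS leq_eqVlt => /predU1P[->|iN].
  exact: (opt_end_exhausted rate arr B0_gt0 opt).
by apply: (opt_boundary_exhausted rate arr B0_gt0 opt std); rewrite iN andbT.
Qed.

(* The energy used by [P] is affine between points where the line of slope [p]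
   through [(S, 0)] is below it. *)
Lemma line_le_cumul t : tm P 1 <= t -> t <= T -> p * (t - S) <= U t.
Proof.
move=> St tT; have [N0 _ S0 lt_tm] := wfP.
have line i : (1 <= i <= N.+1)%N -> p * (tm P i - S) <= U (tm P i).
  move=> /andP[i1 iN]; have [ei|i2] := eqVneq i 1%N.
    rewrite ei cumul_start // pmulr_rle0 // subr_le0; exact: opt_start_le.
  rewrite opt_breakpoint_exhausted; last by rewrite iN ltn_neqAle eq_sym i2 i1.
  apply: line_le_harvested_before; first by apply: le_trans S0 _; exact: tm_le.
  by apply: le_trans opt_finish_le; exact: tm_le.
have [k [kN kt tk]] := find_segment wfP St tT.
have lk := line k; have lk1 := line k.+1.
have {lk lk1}[lk lk1] : p * (tm P k - S) <= U (tm P k) /\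
    p * (tm P k.+1 - S) <= U (tm P k.+1).
  case/andP: kN => k1 kN; split; first by apply: lk; rewrite k1 leqW.
  by apply: lk1; rewrite /= ltnS.
have ltk := lt_tm k kN.
rewrite (cumul_segment wfP _ kN (ltW ltk) (lexx _)) in lk1.
rewrite (cumul_segment wfP _ kN kt tk); move: lk lk1.
move: (U (tm P k)) (pow P k) => u v /= lk lk1.
(* A segment at least as steep as the line is compared from its left end, a flatter one from its
   right end. *)
have [pv|vp] := leP p v.
  have : 0 <= (v - p) * (t - tm P k) by rewrite mulr_ge0 //; lra.
  lra.
have : 0 <= (p - v) * (tm P k.+1 - t) by rewrite mulr_ge0 //; lra.
lra.
Qed.

(** A policy finishing before tau_q, hence before tau_n, has at most the energy E(tau_(n-1)). The
    tangent at [e / Gamma0] then bounds its bits by a number below [B0], by the choice of [n]. *)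
Lemma tau_q_le_finish : 0 < S -> tau q <= T.
Proof.
move=> S0; rewrite leNgt; apply/negP => Tq.
have Tn : T < tau n.
  by apply: lt_le_trans Tq _; rewrite (tau_mono arr) first_q_le.
have n0 : (0 < n)%N := leq_trans (first_q_gt0 S0) (first_q_le S0).
have [N0 _ tm0 _] := wfP.
have T0 : tm P 1 <= T by apply: tm_le.
pose e := E (tau n.-1).
have UT : U T <= e.
  apply: le_trans (opt_energy_before arr opt (le_trans tm0 T0)) _.
  apply: le_trans (harvested_before_le arr T) _.
  rewrite /e -(harvested_before_tauS arr) prednK //.
  exact: harvested_le_before.
have e0 : 0 < e by exact: harvested_tau_gt0.
have a0 : 0 < e / Gamma0 by rewrite divr_gt0.
have := cumul_le_priced rate wfP a0 T0.
rewrite !(cumul_start wfP _ (lexx _)) !subr0 (opt_bits rate opt).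
rewrite on_cumul_without_breaks //; last exact: (opt_pos opt).
rewrite overlap_ge // => bits.
have := sufficient_n.2 n.-1; rewrite prednK // leqnn => /(_ isT); rewrite -/e.
have d0 := opt_duration opt.
have i0 := intercept_gt0 rate a0; have s0 := slope_gt0 rate a0.
have E1 : intercept g (e / Gamma0) * (T - tm P 1) <=
    intercept g (e / Gamma0) * Gamma0 by rewrite ler_pM2l.
have E2 : slope g (e / Gamma0) * U T <= slope g (e / Gamma0) * e.
  by rewrite ler_pM2l.
have -> : g (e / Gamma0) =
    intercept g (e / Gamma0) + slope g (e / Gamma0) * (e / Gamma0).
  by rewrite /intercept subrK.
have eG : e / Gamma0 * Gamma0 = e by rewrite divfK // gt_eqF.
have := congr1 ( *%R (slope g (e / Gamma0))) eG.
move: E1 E2 bits.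
move: (intercept g (e / Gamma0)) (slope g (e / Gamma0)) (e / Gamma0) => x y z.
lra.
Qed.

(** At tau_q the energy used by [P] is squeezed between the line and E(tau_q^-), which coincide, so
    the breakpoint convention lists tau_q. If [S = 0], then tau_q is 0 and [P] starts there. *)
Lemma opt_tau_q : exists j, [/\ (1 <= j <= N.+1)%N, tm P j = tau q
  & energy_used P (tm P j) = Em (tm P j)].
Proof.
have [N0 _ tm0 _] := wfP.
move: S_ge0; rewrite le_eqVlt => /predU1P[S0|S0].
  exists 1%N; have tm1 : tm P 1 = 0.
    by apply: le_anti; rewrite tm0 andbT [leRHS]S0 opt_start_le.
  rewrite first_q_eq0 // (arrival_0 arr) tm1 energy_usedE //.
  by rewrite (harvested_before_0 arr) cumul_start ?tm1.
have [Sq exq _] := first_q.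
have qT := tau_q_le_finish S0.
have qD : tau q <= S + D by apply: le_trans opt_finish_le.
have Pq : tm P 1 <= tau q by apply: le_trans opt_start_le _.
have exPq : exhausted tau En P (tau q).
  rewrite /exhausted energy_usedE //; apply: le_anti.
  rewrite (opt_energy_before arr opt) ?(tau_ge0 arr) //=.
  rewrite -exq energy_usedE // cumulC_mid //; exact: line_le_cumul.
have [j jN jq] := std.1 q Pq qT exPq.
by exists j; split => //; rewrite jq.
Qed.

End TauQ.

(** * Assembly of the two directions *)

Theorem theorem1 (R : realType) (g : R -> R) (tau En : nat -> R)
    (Gamma0 B0 : R) (q : nat) (P : policy R) :
  rate_function g ->
  arrival_process tau En ->
  0 < Gamma0 ->
  0 < B0 ->
  is_tau_q g tau En Gamma0 B0 q ->
  wf_policy P ->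
  without_breaks P ->
  energy_feasible tau En P ->
  standard_breakpoints tau En P ->
  optimal g tau En Gamma0 B0 P <->
  [/\ \sum_(1 <= i < (nseg P).+1) g (pow P i) * (tm P i.+1 - tm P i) = B0,
      forall i, (1 <= i < nseg P)%N -> pow P i <= pow P i.+1,
      (forall i, (2 <= i <= nseg P)%N -> exists j, tm P i = tau j) /\
      (forall i, (2 <= i <= (nseg P).+1)%N ->
         energy_used P (tm P i) = harvested_before tau En (tm P i)),
      (0 < tm P 1 -> tm P (nseg P).+1 - tm P 1 = Gamma0) /\
      (tm P 1 = 0 -> tm P (nseg P).+1 <= Gamma0)
    & exists j, [/\ (1 <= j <= (nseg P).+1)%N, tm P j = tau q
        & energy_used P (tm P j) = harvested_before tau En (tm P j)]].
Proof.
move=> rate arr G0 B00 tauq wfP pos feasP std.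
have [n [D [S]]] := tauq; cbv zeta => -[suff_n [D0 bitsD] startS first_q].
have [N0 p0 tm0 lt_tm] := wfP.
split=> [opt|[bitsP p_mono [_ exhP] [late early] tauqP]].
  split.
  - by rewrite -(cumul_finish wfP g (lexx _)) (opt_bits rate opt).
  - exact: (opt_monotone rate arr B00 opt).
  - split=> -[//|i iN].
      exact: (opt_boundary_arrival rate arr B00 opt std).
    by rewrite energy_usedE // (opt_breakpoint_exhausted rate arr B00 opt std).
  - split; first exact: (opt_late_start rate arr B00 opt).
    by move=> tm10; have := opt_duration opt; rewrite tm10 subr0.
  - exact: (opt_tau_q rate arr G0 B00 suff_n D0 bitsD startS first_q opt std).
have bits : cumul g P (finish P) = B0 by rewrite cumul_finish.
have S_le : tm P 1 <= finish P by apply: tm_le.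
have dur : finish P - tm P 1 <= Gamma0.
  by move: tm0; rewrite le_eqVlt => /predU1P[tm10|/late <-//];
    rewrite -tm10 subr0 early.
split=> // [|Q [wfQ bitsQ feasQ onQ]].
  split=> //; first by rewrite bits_sentE // rate_0.
  by rewrite on_timeE // on_cumul_without_breaks // overlap_ge.
rewrite leNgt; apply/negP => fast.
(* If [P] starts at 0, [Q] cannot be on for longer than [finish Q]; otherwise [P] uses all of
   [Gamma0]. *)
have on_le : on_time Q <= finish P - tm P 1.
  move: tm0; rewrite le_eqVlt => /predU1P[tm10|/late ->//].
  have [NQ _ tmQ0 _] := wfQ; have SQ : tm Q 1 <= finish Q by apply: tm_le.
  have := on_cumul_lip wfQ (le_trans tmQ0 SQ).
  rewrite (cumul_start wfQ _ tmQ0) -on_timeE // min_l // min_r; last by lra.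
  by rewrite -tm10; lra.
have bitsQP : cumul g Q (finish Q) = cumul g P (finish P).
  by rewrite bits -bitsQ bits_sentE // rate_0.
have [tm1 N1] :=
  faster_policy rate arr wfP wfQ pos feasQ p_mono exhP fast on_le bitsQP.
have [j [jN jq exj]] := tauqP.
have q0 : (0 < q)%N.
  rewrite lt0n; apply/eqP => q0; move: jq; rewrite q0 (arrival_0 arr) => jq.
  have : tm P 1 <= tm P j by apply: tm_le => //; case/andP: jN.
  by rewrite jq leNgt tm1.
have S0 : 0 < S.
  have [] := startS; rewrite le_eqVlt => /predU1P[S0|//] _ _.
  by move: q0; rewrite (first_q_eq0 arr D0 startS first_q).
have qn := first_q_le arr D0 startS first_q S0.
have Emq : harvested_before tau En (tau q) = harvested tau En (tau q.-1).
  by rewrite -(harvested_before_tauS arr) prednK.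
move: jN; rewrite N1 => /andP[j1 j2].
move: exj; rewrite {2}jq Emq energy_usedE //.
(* The breakpoint at tau_q is not the start, where no energy has been used although E(tau_(q-1)) is
   positive; so it is the finish. *)
have [ej|j1'] := eqVneq j 1%N.
  rewrite ej cumul_start // => /esym/eqP.
  by rewrite gt_eqF // harvested_tau_gt0.
have -> : j = (nseg P).+1.
  by rewrite N1; move: j1 j2 j1'; clear; case: j => [|[|[|]]].
move: late => /(_ tm1) lateP.
rewrite cumul_finish // N1 big_nat1 /=; move: bitsP lateP.
rewrite N1 big_nat1 => bitsP lateP; rewrite lateP => usedP.
(* [P] sends [B0] bits at constant power over [Gamma0] with energy E(tau_(q-1)), which is
   insufficient as [q.-1 < n]. *)
have := suff_n.2 q.-1; rewrite prednK // => /(_ qn).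
rewrite -usedP mulfK ?gt_eqF // mulrC.
by rewrite -bitsP lateP ltxx.
Qed.
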